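(* Let $(S,\mathcal{S},\mu)$ be a $\sigma$-finite measure space with the approximation-by-averaging property, $q\in[2,\infty)$, $p\in[1,q]$, $X\in L^1(\Omega;L^p(S))$. For all $\ell\in\mathbb{N}$ let $X_\ell\in L^q(\Omega;L^p(S))\cap L^p(S;L^q(\Omega))$, $X_0:=0$, $\xi_\ell:=X_\ell-X_{\ell-1}$, let $\mathcal{C}_\ell$ be the cost of one sample of $\xi_\ell$, and suppose there are $\alpha,\beta,\gamma,C_\alpha,C_\beta,C_\gamma\in(0,\infty)$, $A>1$ and integers $N_\ell\eqsim A^\ell$ with, for all $\ell$, $$\|\mathbb{E}[X]-\mathbb{E}[X_\ell]\|_{L^p(S)}\le C_\alpha N_\ell^{-\alpha},\quad\|X_\ell-\mathbb{E}[X_\ell]-(X_{\ell-1}-\mathbb{E}[X_{\ell-1}])\|_{L^p(S;L^q(\Omega))}\le C_\beta N_\ell^{-\beta},\quad\mathcal{C}_\ell\le C_\gamma N_\ell^\gamma.$$ For each $\ell$ let $(\xi_{\ell,j})_j$ be independent copies of $\xi_\ell$. Then for every $\epsilon\in(0,1/2]$ there exist $L,M_1,\dots,M_L\in\mathbb{N}$ with $$\Big\|\mathbb{E}[X]-\sum_{\ell=1}^L\frac1{M_\ell}\sum_{j=1}^{M_\ell}\xi_{\ell,j}\Big\|_{L^q(\Omega;L^p(S))}<\epsilon$$ at cost $\sum_\ell M_\ell\mathcal{C}_\ell\lesssim\epsilon^{-\gamma/\alpha}+\epsilon^{-2}$ if $\beta>\gamma/2$; $\lesssim\epsilon^{-\gamma/\alpha}+\epsilon^{-2}|\log_A\epsilon|^3$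 if $\beta=\gamma/2$; $\lesssim\epsilon^{-\gamma/\alpha}+\epsilon^{-2-\frac{\gamma-2\beta}{\alpha}}$ if $\beta<\gamma/2$ (implicit constants independent of $\epsilon$).
   Context: Approximation-by-averaging property: for every $n$ there is a finite or countable family $\{B^n_\kappa\}$ of pairwise disjoint measurable sets of positive finite $\mu$-measure such that for every Banach $E$, $p\in[1,\infty)$, $f\in L^p(S;E)$, $\sum_\kappa\mathbf{1}_{B^n_\kappa}\mu(B^n_\kappa)^{-1}\int_{B^n_\kappa}f\,d\mu\to f$ in $L^p(S;E)$. $L^p(S;L^q(\Omega))$-norms of $L^p(S)$-valued random variables are taken for their jointly measurable versions: $(\int_S(\mathbb{E}|\tilde\xi(s,\cdot)|^q)^{p/q}d\mu)^{1/p}$. *)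

(* Defs.v *)
From HB Require Import structures.
From mathcomp Require Import all_boot all_order all_algebra.
From mathcomp Require Import all_classical all_reals all_analysis.
Set Implicit Arguments. Unset Strict Implicit. Unset Printing Implicit Defensive.
Import Order.TTheory GRing.Theory Num.Theory.
Import numFieldNormedType.Exports.
Local Open Scope classical_set_scope.
Local Open Scope ring_scope.

Definition simple_eval {R : realType} {S : Type} {E : normedModType R}
  (k : nat) (A : nat -> set S) (v : nat -> E) (s : S) : E :=
  \sum_(i < k) ((\1_(A i) s : R) *: v i).

Definition strongly_measurable {R : realType} {d} {S : measurableType d}
  (mu : {measure set S -> \bar R}) {E : normedModType R} (f : S -> E) : Prop :=
  exists (k : nat -> nat) (A : nat -> nat -> set S) (v : nat -> nat -> E),
    (forall n i, measurable (A n i)) /\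
    {ae mu, forall s, (fun n => simple_eval (k n) (A n) (v n) s) @ \oo --> f s}.

Definition in_LpE {R : realType} {d} {S : measurableType d}
  (mu : {measure set S -> \bar R}) {E : normedModType R} (p : R) (f : S -> E) : Prop :=
  strongly_measurable mu f /\
  ((\int[mu]_s ((`|f s| `^ p)%:E))%E < +oo)%E.

Definition bochner_integral_is {R : realType} {d} {S : measurableType d}
  (mu : {measure set S -> \bar R}) {E : normedModType R}
  (B : set S) (f : S -> E) (v : E) : Prop :=
  strongly_measurable mu f /\
  exists (k : nat -> nat) (A : nat -> nat -> set S) (w : nat -> nat -> E),
    (forall n i, measurable (A n i) /\ (mu (A n i `&` B) < +oo)%E) /\
    ((fun n => (\int[mu]_(s in B) (`|simple_eval (k n) (A n) (w n) s - f s|)%:E)%E)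
       @ \oo --> 0%E) /\
    ((fun n => \sum_(i < k n) (fine (mu (A n i `&` B)) *: w n i)) @ \oo --> v).

(* The approximation-by-averaging property of (S, mu). The n-th family is
   (Bs n kappa)_{kappa in K n}, K n a (finite or countable) subset of nat. *)
Definition approx_by_averaging {R : realType} {d} {S : measurableType d}
  (mu : {measure set S -> \bar R}) : Prop :=
  exists (K : nat -> set nat) (Bs : nat -> nat -> set S),
    (forall n kappa, K n kappa ->
       measurable (Bs n kappa) /\ (0 < mu (Bs n kappa))%E /\ (mu (Bs n kappa) < +oo)%E) /\
    (forall n kappa kappa', K n kappa -> K n kappa' -> kappa <> kappa' ->
       Bs n kappa `&` Bs n kappa' = set0) /\
    forall (E : completeNormedModType R) (p : R), 1 <= p ->
    forall f : S -> E, in_LpE mu p f ->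
    forall (v : nat -> nat -> E),
      (forall n kappa, K n kappa -> bochner_integral_is mu (Bs n kappa) f (v n kappa)) ->
    forall (g : nat -> S -> E),
      (forall n s,
         (forall kappa, K n kappa -> Bs n kappa s ->
            g n s = (fine (mu (Bs n kappa)))^-1 *: v n kappa) /\
         ((forall kappa, K n kappa -> ~ Bs n kappa s) -> g n s = 0)) ->
      (fun n => (\int[mu]_s ((`|g n s - f s| `^ p)%:E))%E) @ \oo --> 0%E.

(* L^p(S)-valued random variables, represented by jointly measurable   *)
(* versions Y : Omega -> S -> R.                                       *)

Section RV.
Context {R : realType} {dO dS : measure_display}
  {Om : measurableType dO} {S : measurableType dS}.
Variables (P : probability Om R) (mu : {measure set S -> \bar R}).

Definition normLpS (p : R) (f : S -> R) : \bar R := Lnorm mu p%:E (EFin \o f).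

Definition normLqLp (q p : R) (Y : Om -> S -> R) : \bar R :=
  ((\int[P]_w (normLpS p (Y w) `^ q)) `^ q^-1)%E.

Definition normLpLq (p q : R) (Y : Om -> S -> R) : \bar R :=
  ((\int[mu]_s (Lnorm P q%:E (fun w => (Y w s)%:E) `^ p)) `^ p^-1)%E.

Definition LpS_rv (p : R) (Y : Om -> S -> R) : Prop :=
  measurable_fun [set: Om * S] (fun z => Y z.1 z.2) /\
  {ae P, forall w, (normLpS p (Y w) < +oo)%E}.

Definition in_LqLp (q p : R) (Y : Om -> S -> R) : Prop :=
  LpS_rv p Y /\ (normLqLp q p Y < +oo)%E.

Definition in_LpLq (p q : R) (Y : Om -> S -> R) : Prop :=
  LpS_rv p Y /\ (normLpLq p q Y < +oo)%E.

(* expectation E[Y] in L^p(S) (pointwise in s, for the jointly measurable version) *)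
Definition expect (Y : Om -> S -> R) : S -> R :=
  fun s => fine (\int[P]_w (Y w s)%:E)%E.

Definition pairing (Y : Om -> S -> R) (B : set S) : Om -> R :=
  fun w => fine (\int[mu]_(s in B) (Y w s)%:E)%E.

(* cylinder events  { omega | forall i < k, <Y, B_i>(omega) \in U_i } ;
   these form a pi-system generating sigma(Y) for L^p(S)-valued Y *)
Definition cyl (Y : Om -> S -> R) (k : nat) (B : nat -> set S) (U : nat -> set R)
  : set Om := [set w | forall i, (i < k)%N -> U i (pairing Y (B i) w)].

Definition admissible_cyl (k : nat) (B : nat -> set S) (U : nat -> set R) : Prop :=
  forall i, (i < k)%N -> measurable (B i) /\ (mu (B i) < +oo)%E /\ measurable (U i).

Definition same_law (Y Z : Om -> S -> R) : Prop :=
  forall k B U, admissible_cyl k B U -> P (cyl Y k B U) = P (cyl Z k B U).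

Definition indep_family (Y : nat -> Om -> S -> R) : Prop :=
  forall (J : seq nat), uniq J ->
  forall (k : nat -> nat) (B : nat -> nat -> set S) (U : nat -> nat -> set R),
    (forall j, j \in J -> admissible_cyl (k j) (B j) (U j)) ->
    P [set w | forall j, j \in J -> cyl (Y j) (k j) (B j) (U j) w] =
    (\prod_(j <- J) P (cyl (Y j) (k j) (B j) (U j)))%E.

End RV.

Definition mlmc_rate {R : realType} (A alpha beta gamma eps : R) : R :=
  eps `^ (- (gamma / alpha)) +
  (if gamma / 2 < beta then eps `^ (-2)
   else if beta == gamma / 2 then eps `^ (-2) * `|ln eps / ln A| ^+ 3
   else eps `^ (-2 - (gamma - 2 * beta) / alpha)).

(* Main.v *)
Require Import Defs.
From HB Require Import structures.
From mathcomp Require Import all_boot all_order all_algebra.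
From mathcomp Require Import all_classical all_reals all_analysis.
From mathcomp Require Import measurable_realfun ring lra.
Import Order.TTheory GRing.Theory Num.Theory.
Import numFieldNormedType.Exports.
Local Open Scope classical_set_scope.
Local Open Scope ring_scope.
Set Implicit Arguments. Unset Strict Implicit. Unset Printing Implicit Defensive.

(** Only real-valued instances of the averaging property are needed.  For almost
    every [w], the error [err w] of one level, a function in [L^p(S)], is the limit
    in [L^p(S)] of step functions whose coefficient on a block [B] is the average
    of [err w] over [B].  These coefficients are normalized sums of independent
    copies of the real random variable [<xi, B>], because the cylinder events
    determine the joint law of the pairings with one fixed block.

    For real centred summands the rate [M^(-1/2)] in [L^q] follows by induction on
    the number of summands from the Taylor-type inequality
    [|x + y|^q <= (1 + 1/(2m)) |x|^q + q |x|^(q-2) x y + C m^(q/2-1) |y|^q],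
    whose linear term vanishes in expectation.  Jensen's inequality on [B] and
    Minkowski's integral inequality [|| . ||_(L^q(Omega; L^p)) <= || . ||_(L^p(S; L^q))] (this is
    where [p <= q] enters) turn it into a bound for the step functions by
    [C M^(-1/2) ||xi - E xi||_(L^p(S; L^q))], and Fatou's lemma passes to the limit.

    The biases telescope, and the sample sizes are chosen by splitting the error
    tolerance over the levels with geometric or constant weights. *)
(** * Inequalities for real powers *)


(** The factor 1 + 1/(2m) is what lets the induction on the number of summands close: since q/2 >=
    1, passing from m^(q/2) to (m+1)^(q/2) gains at least (q/2) m^(q/2-1), while the factor consumes
    only m^(q/2-1)/2; the rest pays for the |y|^q term once the overall constant is large. On blocks
    every estimate is kept in the form of p-th powers, because the p-th power of the L^p(S; L^q)
    norm is additive over disjoint sets; the root is taken only after summation over the blocks. The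
    step functions converge outcome by outcome and no dominating function is at hand. The limit
    therefore passes through a lower limit in n, against a bound that is uniform in n. The cubed
    logarithm of the critical regime comes from L levels with equal shares 1/L of the tolerance:
    each share costs L^2, and there are L of them, with L of the order of the logarithm. *)

Section PowerInequalities.
Context {R : realType}.
Implicit Types (q r a c x y : R).

(** Young's inequality for a and c^(r-1), with exponents r and r/(r-1), is this tangent inequality
    rearranged. It stands in for derivatives in the Taylor bound, the moment recursion, Jensen's
    inequality and the lower semicontinuity of the norm. *)
Lemma powR_tangent r a c : 1 <= r -> 0 <= a -> 0 <= c ->
  c `^ r + r * c `^ (r - 1) * (a - c) <= a `^ r.
Proof.
rewrite le_eqVlt => /predU1P[<- a0 c0|r1 a0 c0].
  by rewrite subrr !powRr0 !powRr1//; lra.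
have r0 : 0 < r by lra.
have s0 : 0 < r - 1 by lra.
have := @conjugate_powR R a (c `^ (r - 1)) r (r / (r - 1)) a0 (powR_ge0 _ _) r0.
rewrite divr_gt0// => /(_ isT).
have -> : r^-1 + (r / (r - 1))^-1 = 1 by field; rewrite !gt_eqF.
move=> /(_ erefl).
rewrite -powRrM (_ : (r - 1) * (r / (r - 1)) = r); last by field; rewrite gt_eqF.
rewrite -(ler_pM2l r0) => H.
have cE : c * c `^ (r - 1) = c `^ r by rewrite mulr_powRB1.
suff : r * (a `^ r / r + c `^ r / (r / (r - 1))) = a `^ r + (r - 1) * c `^ r.
  move: H => /[swap] ->; rewrite -cE; lra.
by field; rewrite !gt_eqF.
Qed.

Lemma le_add1_powR r x : 0 <= x -> 1 <= r -> x <= 1 + x `^ r.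
Proof.
move=> x0 r1; have [x1|x1] := leP x 1; first by rewrite (le_trans x1)// lerDl powR_ge0.
by rewrite (le_trans (le1r_powR (ltW x1) r1))// lerDr.
Qed.

(** Two tangents and no second derivative: the tangent at b = a + y gives the slope b^(q-1), and a
    tangent for the exponent q - 1 trades b^(q-1) for a^(q-1). The latter is taken at b or at a
    according to the sign of y, so that multiplication by y goes the right way. *)
Lemma powR_taylor_near q a y : 2 <= q -> 0 < a -> 0 <= a + y -> a + y <= 2 * a ->
  (a + y) `^ q <= a `^ q + q * a `^ (q - 2) * a * y
    + q * (q - 1) * 2 `^ (q - 2) * (a `^ (q - 2) * y ^+ 2).
Proof.
move=> q2 a0 b0 b2.
have q1 : 1 <= q by lra.
have q11 : 1 <= q - 1 by lra.
set b := a + y in b0 b2 *.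
have H1 : b `^ q <= a `^ q + q * b `^ (q - 1) * y.
  have := powR_tangent q1 (ltW a0) b0; rewrite /b; lra.
have aE : a `^ (q - 2) * a = a `^ (q - 1).
  by rewrite mulrC -(@mulr_powRB1 _ a (q - 1))//; [congr (_ * _ `^ _); ring|lra|lra].
have a2 : 0 <= a `^ (q - 2) by exact: powR_ge0.
have h2 : 1 <= 2 `^ (q - 2) :> R.
  by rewrite -[leLHS](powRr0 2) ler_powR//; lra.
have H2 : (b `^ (q - 1) - a `^ (q - 1)) * y
   <= (q - 1) * 2 `^ (q - 2) * (a `^ (q - 2) * y ^+ 2).
  have [y0|y0] := leP 0 y.
    have := powR_tangent q11 (ltW a0) b0.
    rewrite (_ : q - 1 - 1 = q - 2); last by ring.
    have bb : b `^ (q - 2) <= 2 `^ (q - 2) * a `^ (q - 2).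
      rewrite -powRM//; last lra.
      by apply: ge0_ler_powR => //; rewrite ?nnegrE; lra.
    have : 0 <= (q - 1) * y ^+ 2 by rewrite mulr_ge0 ?sqr_ge0//; lra.
    move=> /ler_wpM2l /(_ _ _ bb) H1' H; have := ler_wpM2r y0 H; move: H1'; rewrite /b; lra.
  have := powR_tangent q11 b0 (ltW a0).
  rewrite (_ : q - 1 - 1 = q - 2); last by ring.
  have : 0 <= (q - 1) * (a `^ (q - 2) * y ^+ 2).
    by apply: mulr_ge0; [lra|rewrite mulr_ge0 ?sqr_ge0].
  move=> /ler_wpM2r /(_ _ _ h2) H1' H; have := ler_wnM2r (ltW y0) H; move: H1'; rewrite /b; lra.
rewrite -(mulrA q (a `^ _)) aE.
have := ler_wpM2l (_ : 0 <= q) H2.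
have : 0 <= q by lra.
move=> q0 /(_ q0); lra.
Qed.

(** If |x| <= 2|y|, all terms compare with |y|^q: |x + y| <= 3|y|, and the linear term is at most q
    2^(q-1) |y|^q, whence [K2]. Otherwise x + y has the sign of x and modulus at most 2|x|, and
    [powR_taylor_near] applies to x, y or to their opposites. *)
Lemma normr_powRD_le q : 2 <= q -> exists2 C : R, 0 < C & forall x y,
  `|x + y| `^ q <= `|x| `^ q + q * `|x| `^ (q - 2) * x * y
    + C * (`|x| `^ (q - 2) * y ^+ 2) + C * `|y| `^ q.
Proof.
move=> q2; pose K := q * (q - 1) * 2 `^ (q - 2) : R.
pose K2 := 3 `^ q + q * 2 `^ (q - 1) : R.
have q1 : 0 < q - 1 by lra.
have q0 : 0 < q by lra.
have p2 r : 0 < 2 `^ r :> R by rewrite powR_gt0.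
have p3 r : 0 < 3 `^ r :> R by rewrite powR_gt0.
have K0 : 0 < K by rewrite !mulr_gt0.
have K20 : 0 < K2 by rewrite addr_gt0// mulr_gt0.
exists (K + K2) => [|x y]; first exact: addr_gt0.
have t1 : 0 <= `|x| `^ (q - 2) * y ^+ 2 by rewrite mulr_ge0 ?powR_ge0 ?sqr_ge0.
have t2 : 0 <= `|y| `^ q by exact: powR_ge0.
have [xy|xy] := leP `|x| (2 * `|y|).
  have A1 : `|x + y| `^ q <= 3 `^ q * `|y| `^ q.
    rewrite -powRM//; apply: ge0_ler_powR => //; rewrite ?nnegrE ?mulr_ge0//.
      exact: ltW.
    by apply: (le_trans (ler_normD _ _)); lra.
  have A2 : - (q * `|x| `^ (q - 2) * x * y) <= q * (2 `^ (q - 1) * `|y| `^ q).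
    apply: (le_trans (ler_norm _)); rewrite normrN !normrM (ger0_norm (ltW q0)).
    rewrite (ger0_norm (powR_ge0 _ _)) -!mulrA; apply: ler_wpM2l; first exact: ltW.
    have -> : `|x| `^ (q - 2) * (`|x| * `|y|) = `|x| `^ (q - 1) * `|y|.
      rewrite mulrA; congr (_ * _).
      by rewrite mulrC -(@mulr_powRB1 _ `|x| (q - 1))//; congr (_ * _ `^ _); ring.
    rewrite -(@mulr_powRB1 _ `|y| q)// [_ * (`|y| * _)]mulrCA.
    rewrite [leRHS]mulrC; apply: ler_wpM2r => //.
    rewrite -powRM//; apply: ge0_ler_powR => //; rewrite ?nnegrE ?mulr_ge0//.
    exact: ltW.
  have := mulr_ge0 (addr_ge0 (ltW K0) (ltW K20)) t1.
  have := mulr_ge0 (ltW K0) t2.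
  have := powR_ge0 `|x| q.
  by rewrite /K2; lra.
have := mulr_ge0 (addr_ge0 (ltW K0) (ltW K20)) t2.
have := mulr_ge0 (ltW K20) t1.
suff : `|x + y| `^ q <= `|x| `^ q + q * `|x| `^ (q - 2) * x * y
    + K * (`|x| `^ (q - 2) * y ^+ 2) by lra.
have [x0|x0] := leP 0 x.
  have yx := ler_norm y; have yx' := ler_norm (- y); rewrite normrN in yx'.
  have x1 : 0 < x by move: xy; rewrite (ger0_norm x0); have := normr_ge0 y; lra.
  rewrite (ger0_norm x0); rewrite (ger0_norm x0) in xy.
  rewrite ger0_norm; last lra.
  by apply: powR_taylor_near => //; lra.
have yx := ler_norm y; have yx' := ler_norm (- y); rewrite normrN in yx'.
rewrite (ltr0_norm x0); rewrite (ltr0_norm x0) in xy.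
have -> : `|x + y| = - x - y by rewrite ler0_norm ?opprD//; lra.
have := @powR_taylor_near q (- x) (- y) q2.
rewrite oppr_gt0 x0 sqrrN => /(_ isT).
have -> : q * (- x) `^ (q - 2) * - x * - y = q * (- x) `^ (q - 2) * x * y by ring.
by apply; lra.
Qed.

(* Young's inequality with a weight adapted to the recursion on the number m
   of summands: the coefficient of |x|^q only costs a factor 1 + 1/(2m). *)
Lemma normr_powRD_step q : 2 <= q -> exists2 C : R, 0 < C & forall m x y, 1 <= m ->
  `|x + y| `^ q <= (1 + (2 * m)^-1) * `|x| `^ q + q * `|x| `^ (q - 2) * x * y
    + C * m `^ (q / 2 - 1) * `|y| `^ q.
Proof.
move=> q2; have [K K0 HK] := normr_powRD_le q2.
pose K' := K * (2 * K) `^ (q / 2 - 1).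
have K'0 : 0 <= K' by rewrite mulr_ge0 ?powR_ge0// ltW.
exists (K + K') => [|m x y m1]; first by rewrite ltr_pwDl.
have m0 : 0 < m by lra.
apply: (le_trans (HK x y)).
have m2 : 1 <= m `^ (q / 2 - 1) by rewrite -[leLHS](powRr0 m) ler_powR//; lra.
have yq : 0 <= `|y| `^ q := powR_ge0 _ _.
have A : K * `|y| `^ q <= K * m `^ (q / 2 - 1) * `|y| `^ q.
  by apply: ler_wpM2r => //; rewrite ler_peMr// ltW.
suff : K * (`|x| `^ (q - 2) * y ^+ 2) <=
   (2 * m)^-1 * `|x| `^ q + K' * m `^ (q / 2 - 1) * `|y| `^ q by lra.
have xE z : `|z| `^ q = `|z| `^ (q - 2) * z ^+ 2.
  rewrite -real_normK ?num_real// -powR_mulrn//.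
  by rewrite -powRD ?subrK//; apply/implyP => /eqP; lra.
have xq : 0 <= `|x| `^ (q - 2) := powR_ge0 _ _.
(* Either K y^2 is at most x^2/(2m) and the quadratic term is absorbed by |x|^q/(2m), or x^2 < 2Km
   y^2 and |x|^(q-2) is at most (2Km)^(q/2-1) |y|^(q-2), whence [K']. *)
have [xy|xy] := leP (2 * K * m * y ^+ 2) (x ^+ 2).
  have : K * y ^+ 2 <= (2 * m)^-1 * x ^+ 2.
    by rewrite ler_pdivlMl ?mulr_gt0//; lra.
  move=> /(ler_wpM2l xq).
  have : 0 <= K' * m `^ (q / 2 - 1) * `|y| `^ q by apply: mulr_ge0; [apply: mulr_ge0|]; rewrite ?powR_ge0.
  by rewrite (xE x); lra.
have B : `|x| `^ (q - 2) <= (2 * K) `^ (q / 2 - 1) * m `^ (q / 2 - 1) * `|y| `^ (q - 2).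
  have half z : `|z| `^ (q - 2) = (z ^+ 2) `^ (q / 2 - 1).
    rewrite -real_normK ?num_real// -powR_mulrn// -powRrM; congr (_ `^ _).
    by field.
  have K2 : 0 <= 2 * K by lra.
  have m0' := ltW m0.
  have Km : 0 <= 2 * K * m by exact: mulr_ge0.
  rewrite !half -powRM// -powRM ?sqr_ge0//.
  apply: ge0_ler_powR; rewrite ?nnegrE ?sqr_ge0//; last exact: ltW.
    lra.
  by apply: mulr_ge0 => //; exact: sqr_ge0.
have B' : K * (`|x| `^ (q - 2) * y ^+ 2) <= K * (((2 * K) `^ (q / 2 - 1)
    * m `^ (q / 2 - 1) * `|y| `^ (q - 2)) * y ^+ 2).
  by apply: ler_wpM2l; [exact: ltW|exact: ler_wpM2r (sqr_ge0 _) _ _ B].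
have : 0 <= (2 * m)^-1 * `|x| `^ q.
  by apply: mulr_ge0; [rewrite invr_ge0; lra|exact: powR_ge0].
by rewrite (xE y) /K'; lra.
Qed.

(** With t = m^(q/2-1), the tangent at m yields (m+1)^(q/2) >= m t + (q/2) t, and (1 + 2C) t/2 + C t
    <= (1 + 2C) t <= (1 + 2C) (q/2) t. *)
Lemma moment_recursion q C m : 2 <= q -> 0 <= C -> 1 <= m ->
  (1 + (2 * m)^-1) * ((1 + 2 * C) * m `^ (q / 2)) + C * m `^ (q / 2 - 1)
    <= (1 + 2 * C) * (m + 1) `^ (q / 2).
Proof.
move=> q2 C0 m1.
have r1 : 1 <= q / 2 by lra.
have := @powR_tangent (q / 2) (m + 1) m r1.
have -> : m + 1 - m = 1 by ring.
rewrite mulr1 => /(_ ltac:(lra) ltac:(lra)).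
rewrite -(@mulr_powRB1 _ m (q / 2)); [|lra|lra].
set t := m `^ _; set u := (m + 1) `^ _ => H.
have t0 : 0 <= t := powR_ge0 _ _.
have -> : (1 + (2 * m)^-1) * ((1 + 2 * C) * (m * t)) = (1 + 2 * C) * (m * t + t / 2).
  by field; apply/eqP; lra.
apply: (@le_trans _ _ ((1 + 2 * C) * (m * t + q / 2 * t))).
  have : (1 + 2 * C) * t <= (1 + 2 * C) * (q / 2 * t).
    by rewrite ler_wpM2l ?addr_ge0 ?mulr_ge0// ler_peMl.
  lra.
by rewrite ler_wpM2l// addr_ge0// mulr_ge0.
Qed.

End PowerInequalities.

(** * Moments of sums of independent centred variables *)


Lemma measurable_normr_powR {R : realType} d (T : measurableType d) (g : T -> R) q :
  measurable_fun setT g -> measurable_fun setT (fun x => (`|g x| `^ q)%:E).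
Proof.
move=> mg; apply/measurable_EFinP.
apply: (@measurableT_comp _ _ _ _ _ _ (fun x => x `^ q)) => //.
exact: measurableT_comp.
Qed.

Section Independence.
Context {R : realType} {d : measure_display} {Om : measurableType d}.
Variable P : probability Om R.

Definition mutually_indep (Z : nat -> Om -> R) :=
  forall (J : seq nat) (U : nat -> set R), uniq J ->
  (forall j, j \in J -> measurable (U j)) ->
  P [set w | forall j, j \in J -> U j (Z j w)] =
  (\prod_(j <- J) P (Z j @^-1` U j))%E.

(** Both sides are finite measures in A that agree on rectangles, a pi-system generating the product
    sigma-algebra. This reaches events on X + Y, which are not rectangles. *)
Lemma joint_indep_event (X Y : {mfun Om >-> R}) (E : set Om) : measurable E ->
  (forall V U, measurable V -> measurable U ->
     P (X @^-1` V `&` Y @^-1` U `&` E) = (P (X @^-1` V `&` Y @^-1` U) * P E)%E) ->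
  forall A : set (R * R), measurable A ->
  P ((fun w => (X w, Y w)) @^-1` A `&` E) =
  (P ((fun w => (X w, Y w)) @^-1` A) * P E)%E.
Proof.
move=> mE H A mA.
have mXY : measurable_fun setT (fun w => (X w, Y w) : R * R).
  by apply: measurable_fun_pair; exact: measurable_funP.
pose XY : {mfun Om >-> (R * R)%type} := mfun_Sub (mem_set mXY).
have PE0 : 0 <= fine (P E) by rewrite fine_ge0.
pose k1 : {measure set (R * R) -> \bar R} := pushforward (mrestr P mE) XY.
pose k2 : {measure set (R * R) -> \bar R} := mscale (NngNum PE0) (pushforward P XY).
pose m1 := k1 mXY; pose m2 := k2 mXY.
have PE : (fine (P E))%:E = P E by rewrite fineK// fin_num_measure.
suff -> : P ((fun w => (X w, Y w)) @^-1` A `&` E) = m2 A.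
  by rewrite /m2 /k2 /= /mscale /= PE muleC.
have -> : P ((fun w => (X w, Y w)) @^-1` A `&` E) = m1 A by [].
pose C : set (set (R * R)) :=
  [set C | exists A, measurable A /\ exists B, measurable B /\ C = A `*` B].
apply: (measure_unique C (fun _ => setT)) => //.
- rewrite measurable_prod_measurableType //; congr (<<s _ >>).
  rewrite predeqE; split => [[A1 mA1 [B mB <-]]|[A1 [mA1 [B [mB ->]]]]].
    by exists A1; split => //; exists B.
  by exists A1 => //; exists B.
- move=> /= _ _ [X1 [mX1 [X2 [mX2 ->]]]] [Y1 [mY1 [Y2 [mY2 ->]]]].
  rewrite -setXI; exists (X1 `&` Y1); split; first exact: measurableI.
  by exists (X2 `&` Y2); split => //; exact: measurableI.
- by move=> _; exists setT; split => //; exists setT; split => //; rewrite setXTT.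
- by rewrite bigcup_const.
- move=> _ [V [mV [U [mU ->]]]].
  by rewrite /m1 /m2 /k1 /k2 /= /mscale /= PE muleC -H.
- by move=> _; rewrite /m1 /k1 /= /pushforward /mrestr/= preimage_setT setTI (le_lt_trans (probability_le1 _ _))// ltry.
Qed.

(** The list J of later indices is what the induction needs: to add the summand m + 1, the
    hypothesis for m is used with m + 1 moved among the later indices, and [joint_indep_event] then
    merges the partial sum with the new summand. *)
Lemma mutually_indep_sum (Z : nat -> {mfun Om >-> R}) : mutually_indep Z ->
  forall m (J : seq nat) (U : nat -> set R) (V : set R), uniq J ->
  (forall j, j \in J -> (m < j)%N /\ measurable (U j)) -> measurable V ->
  P ((fun w => \sum_(1 <= j < m.+1) Z j w) @^-1` V
       `&` [set w | forall j, j \in J -> U j (Z j w)]) =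
  (P ((fun w => \sum_(1 <= j < m.+1) Z j w)%R @^-1` V) *
   P [set w | forall j, j \in J -> U j (Z j w)])%E.
Proof.
move=> iZ; have mev (J : seq nat) U : (forall j, j \in J -> measurable (U j)) ->
    measurable [set w | forall j, j \in J -> U j (Z j w)].
  move=> mU; rewrite (_ : mkset _ = \bigcap_(j in [set` J]) (Z j @^-1` U j))//.
  apply: fin_bigcap_measurable => [|j jJ]; first exact: finite_seq.
  by rewrite -[X in measurable X]setTI; apply: measurable_funP => //; exact: mU.
have mS m : measurable_fun setT (fun w => \sum_(1 <= j < m.+1) Z j w).
  by apply: measurable_sum => j; exact: measurable_funP.
elim=> [|m IH] J U V uJ HJ mV.
  under eq_fun do rewrite big_geq//.
  have [V0|V0] := pselect (V 0).
    have -> : (fun=> 0) @^-1` V = [set: Om] by apply/seteqP; split.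
    by rewrite setTI probability_setT mul1e.
  have -> : (fun=> 0) @^-1` V = @set0 Om by apply/seteqP; split.
  by rewrite set0I measure0 mul0e.
pose S : {mfun Om >-> R} := mfun_Sub (mem_set (mS m)).
have mJ : measurable [set w | forall j, j \in J -> U j (Z j w)].
  by apply: mev => j /HJ[].
have mA : measurable ((fun z : R * R => z.1 + z.2) @^-1` V).
  rewrite -[X in measurable X]setTI.
  by apply: (measurable_funD measurable_fst measurable_snd).
have SE : (fun w => \sum_(1 <= j < m.+2) Z j w) =
    (fun z => z.1 + z.2) \o (fun w => (S w, Z m.+1 w)).
  by apply/funext => w /=; rewrite big_nat_recr.
rewrite SE comp_preimage.
apply: (@joint_indep_event S (Z m.+1)) => // V' U' mV' mU'.
have mJn : m.+1 \notin J by apply/negP => /HJ[]; rewrite ltnn.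
pose U2 j := if j == m.+1 then U' else U j.
have E1 : [set w | forall j, j \in [:: m.+1] -> U2 j (Z j w)] = Z m.+1 @^-1` U'.
  apply/seteqP; split => w /=.
    by move=> /(_ m.+1); rewrite mem_head /U2 eqxx; exact.
  by move=> h j; rewrite inE /U2 => /eqP ->; rewrite eqxx.
have E2 : [set w | forall j, j \in m.+1 :: J -> U2 j (Z j w)] =
    Z m.+1 @^-1` U' `&` [set w | forall j, j \in J -> U j (Z j w)].
  apply/seteqP; split => w /=.
    move=> h; split; first by have := h m.+1; rewrite mem_head /U2 eqxx; exact.
    move=> j jJ; have := h j; rewrite inE jJ orbT /U2 => /(_ isT).
    by case: eqP => // je; move: mJn; rewrite -je jJ.
  move=> [h1 h2] j; rewrite inE /U2; case: eqP => [-> //|_ /=]; exact: h2.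
have mU2 j : j \in m.+1 :: J -> (m < j)%N /\ measurable (U2 j).
  rewrite inE /U2; case: eqP => [->//|_ /= /HJ[h ?]]; split => //.
  exact: ltnW.
have mU1 j : j \in [:: m.+1] -> (m < j)%N /\ measurable (U2 j).
  by rewrite inE /U2 => /eqP ->; rewrite eqxx.
have := IH (m.+1 :: J) U2 V' _ mU2 mV'; rewrite /= mJn uJ E2 => /(_ isT).
rewrite -/(S : Om -> R) setIA => ->.
have := IH [:: m.+1] U2 V' isT mU1 mV'; rewrite E1 -/(S : Om -> R) => ->.
have := @iZ (m.+1 :: J) U2; rewrite /= mJn uJ E2 => /(_ isT) ->; last first.
  by move=> j /mU2[].
rewrite big_cons /U2 eqxx muleA; congr (_ * _)%E.
rewrite iZ//; last by move=> j /HJ[].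
apply: eq_big_seq => j jJ; case: eqP => // je.
by move: mJn; rewrite -je jJ.
Qed.

Lemma integral_cst_probability d' (T : measurableType d') (Q : probability T R)
  (a : \bar R) : (\int[Q]_x a = a)%E.
Proof.
rewrite integral_cst// -[RHS]mule1; congr (_ * _)%E.
exact: (@probability_setT _ _ _ Q).
Qed.

Lemma integral_affine2 d' (T : measurableType d') (Q : probability T R)
  (f g : T -> R) (a b c : R) :
  Q.-integrable setT (EFin \o f) -> Q.-integrable setT (EFin \o g) ->
  (\int[Q]_x (a + b * f x + c * g x)%:E =
   a%:E + b%:E * \int[Q]_x (f x)%:E + c%:E * \int[Q]_x (g x)%:E)%E.
Proof.
move=> If Ig.
have Ia : Q.-integrable setT (EFin \o cst a) by exact: finite_measure_integrable_cst.
have Ibf : Q.-integrable setT (EFin \o (fun x => b * f x)).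
  exact: (integrableZl measurableT b If).
have Icg : Q.-integrable setT (EFin \o (fun x => c * g x)).
  exact: (integrableZl measurableT c Ig).
have Iab : Q.-integrable setT (EFin \o (fun x => a + b * f x)).
  exact: (integrableD measurableT Ia Ibf).
transitivity (\int[Q]_x (a + b * f x)%:E + \int[Q]_x (c * g x)%:E)%E.
  rewrite -(integralD_EFin measurableT Iab Icg).
  by apply: eq_integral => x _; rewrite /= EFinD.
congr (_ + _)%E; last first.
  by rewrite -integralZl//; apply: eq_integral => x _; rewrite EFinM.
transitivity (\int[Q]_x a%:E + \int[Q]_x (b * f x)%:E)%E.
  rewrite -(integralD_EFin measurableT Ia Ibf).
  by apply: eq_integral => x _; rewrite /= EFinD.
congr (_ + _)%E.
  exact: integral_cst_probability.
by rewrite -integralZl//; apply: eq_integral => x _; rewrite EFinM.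
Qed.

(** By independence the law of (X, Y) is a product, and Tonelli allows integration over y first. For
    fixed x the linear term is then a constant times y and vanishes, whether or not |X|^(q-2) X is
    integrable. *)
Lemma moment_indep_step (q C m : R) (X Y : {mfun Om >-> R}) : 2 <= q -> 1 <= m ->
  (forall x y, `|x + y| `^ q <= (1 + (2 * m)^-1) * `|x| `^ q
    + q * `|x| `^ (q - 2) * x * y + C * m `^ (q / 2 - 1) * `|y| `^ q) ->
  (forall V U, measurable V -> measurable U ->
     P (X @^-1` V `&` Y @^-1` U) = (P (X @^-1` V) * P (Y @^-1` U))%E) ->
  P.-integrable setT (EFin \o Y) -> (\int[P]_w (Y w)%:E = 0)%E ->
  P.-integrable setT (fun w => (`|Y w| `^ q)%:E) ->
  0 <= C ->
  (\int[P]_w (`|X w + Y w| `^ q)%:E <= (1 + (2 * m)^-1)%:E * \int[P]_w (`|X w| `^ q)%:E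
    + (C * m `^ (q / 2 - 1))%:E * \int[P]_w (`|Y w| `^ q)%:E)%E.
Proof.
move=> q2 m1 H iXY IY EY IYq C0.
have mXY : measurable_fun setT (fun w => (X w, Y w) : R * R).
  by apply: measurable_fun_pair; exact: measurable_funP.
pose XY : {mfun Om >-> (R * R)%type} := mfun_Sub (mem_set mXY).
have mF : measurable_fun setT (fun z : R * R => (`|z.1 + z.2| `^ q)%:E).
  by apply: measurable_normr_powR => //; exact: (measurable_funD measurable_fst measurable_snd).
have mG : measurable_fun setT (fun z : R => (`|z| `^ q)%:E).
  by apply: measurable_normr_powR => //; exact: measurable_id.
have -> : (\int[P]_w (`|X w + Y w| `^ q)%:E =
    \int[distribution P XY]_z (`|z.1 + z.2| `^ q)%:E)%E.
  by rewrite ge0_integral_distribution// => z; rewrite lee_fin powR_ge0.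
have -> : (\int[distribution P XY]_z (`|z.1 + z.2| `^ q)%:E =
   \int[distribution P X \x distribution P Y]_z (`|z.1 + z.2| `^ q)%:E)%E.
  apply: eq_measure_integral => A mA _; apply/esym.
  by apply: product_measure_unique => // V U mV mU /=; exact: iXY.
rewrite fubini_tonelli1//=.
rewrite /fubini_F/=.
have mI : measurable_fun setT (EFin \o @id R) by exact: EFin_measurable.
have IYd : (distribution P Y).-integrable setT (EFin \o id).
  exact: integrable_pushforward.
have IYqd : (distribution P Y).-integrable setT (fun y => (`|y| `^ q)%:E).
  exact: integrable_pushforward.
have EYd : (\int[distribution P Y]_y y%:E = 0)%E.
  by rewrite integral_distribution.
have EYqd : (\int[distribution P Y]_y (`|y| `^ q)%:E = \int[P]_w (`|Y w| `^ q)%:E)%E.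
  by rewrite integral_distribution.
have fb : (\int[P]_w (`|Y w| `^ q)%:E)%E \is a fin_num by exact: integrable_fin_num.
have b0 : (0 <= \int[P]_w (`|Y w| `^ q)%:E)%E.
  by apply: integral_ge0 => w _; rewrite lee_fin powR_ge0.
set b := (\int[P]_w (`|Y w| `^ q)%:E)%E in fb b0 EYqd *.
have c0 : 0 <= C * m `^ (q / 2 - 1) by rewrite mulr_ge0 ?powR_ge0.
have c1 : 0 <= 1 + (2 * m)^-1 by rewrite addr_ge0// invr_ge0; lra.
apply: (@le_trans _ _ (\int[distribution P X]_x
   ((1 + (2 * m)^-1)%:E * (`|x| `^ q)%:E + (C * m `^ (q / 2 - 1))%:E * b))%E).
  apply: ge0_le_integral => //.
  - by move=> x _; apply: integral_ge0 => y _; rewrite lee_fin powR_ge0.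
  - exact: (@measurable_fun_fubini_tonelli_F _ _ _ _ _ _ (fun z : R * R => (`|z.1 + z.2| `^ q)%:E)).
  - by apply: emeasurable_funD => //; exact: measurable_funeM.
  move=> x _.
  pose k1 := q * `|x| `^ (q - 2) * x.
  apply: (@le_trans _ _ (\int[distribution P Y]_y
     ((1 + (2 * m)^-1) * `|x| `^ q + k1 * y + C * m `^ (q / 2 - 1) * `|y| `^ q)%:E)%E).
    have mm : measurable_fun setT (fun y : R => (`|x + y| `^ q)%:E).
      by apply: measurable_normr_powR => //; exact: measurable_funD.
    apply: ge0_le_integral => //.
    - apply/measurable_EFinP; apply: measurable_funD.
        by apply: measurable_funD => //; exact: measurable_funM.
      by apply: measurable_funM => //; exact/measurable_EFinP.
    - by move=> y _; rewrite lee_fin.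
  by rewrite (integral_affine2 _ _ _ IYd IYqd)/= EYd mule0 adde0 EYqd EFinM.
rewrite ge0_integralD//; first last.
- by move=> x _; rewrite mule_ge0.
- exact: measurable_funeM.
- by move=> x _; rewrite mule_ge0 ?lee_fin ?powR_ge0.
rewrite integral_cst_probability.
rewrite ge0_integralZl//.
by rewrite ge0_integral_distribution.
Qed.

Lemma moment_sum_le (q : R) : 2 <= q -> exists2 D : R, 0 < D &
  forall (Z : nat -> {mfun Om >-> R}) (b : R), mutually_indep Z ->
  (forall j, P.-integrable setT (EFin \o Z j)) ->
  (forall j, \int[P]_w (Z j w)%:E = 0)%E ->
  (forall j, \int[P]_w (`|Z j w| `^ q)%:E = b%:E)%E ->
  forall m, (0 < m)%N ->
  (\int[P]_w (`|\sum_(1 <= j < m.+1) Z j w|%R `^ q)%:E <=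
    (D * m%:R `^ (q / 2) * b)%:E)%E.
Proof.
move=> q2; have [C C0 HC] := @normr_powRD_step R q q2.
(* The 1 covers a single summand, the 2C the recursion. *)
exists (1 + 2 * C) => [|Z b iZ IZ EZ EZq]; first by lra.
have b0 : 0 <= b.
  by rewrite -lee_fin -(EZq 0%N); apply: integral_ge0 => w _; rewrite lee_fin powR_ge0.
have IZq j : P.-integrable setT (fun w => (`|Z j w| `^ q)%:E).
  apply/integrableP; split.
    exact: measurable_normr_powR.
  under eq_integral do rewrite gee0_abs ?lee_fin ?powR_ge0//.
  by rewrite EZq ltry.
case=> // m _; elim: m => [|m IH].
  under eq_integral do rewrite big_nat1.
  by rewrite EZq lee_fin powR1 mulr1 ler_peMl//; lra.
have mS : measurable_fun setT (fun w => \sum_(1 <= j < m.+2) Z j w).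
  by apply: measurable_sum => j; exact: measurable_funP.
pose S : {mfun Om >-> R} := mfun_Sub (mem_set mS).
have m1 : 1 <= m.+1%:R :> R by rewrite ler1n.
have := @moment_indep_step q C m.+1%:R S (Z m.+2) q2 m1 (fun x y => HC _ x y m1).
move=> /(_ _ (IZ _) (EZ _) (IZq _) (ltW C0)) => H.
under eq_integral do rewrite big_nat_recr//=.
apply: (le_trans (H _)).
  move=> V U mV mU.
  have := @mutually_indep_sum Z iZ m.+1 [:: m.+2] (fun=> U) V isT _ mV.
  have -> : [set w | forall j, j \in [:: m.+2] -> U (Z j w)] = Z m.+2 @^-1` U.
    apply/seteqP; split => w /=; first by move=> /(_ m.+2); rewrite mem_head; exact.
    by move=> h j; rewrite inE => /eqP ->.
  by apply => j; rewrite inE => /eqP ->.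
rewrite EZq; have c1 : 0 <= 1 + (2 * m.+1%:R)^-1 :> R by rewrite addr_ge0// invr_ge0; lra.
apply: (@le_trans _ _ ((1 + (2 * m.+1%:R)^-1)%:E * ((1 + 2 * C) * m.+1%:R `^ (q / 2) * b)%:E
   + (C * m.+1%:R `^ (q / 2 - 1))%:E * b%:E)%E).
  by rewrite leeD2r// lee_wpmul2l.
rewrite -!EFinM -EFinD lee_fin.
have := ler_wpM2r b0 (moment_recursion q2 (ltW C0) m1).
rewrite (natr1 m.+1) mulrDl.
move: (m.+1%:R `^ (q / 2)) (m.+1%:R `^ (q / 2 - 1)) (m.+2%:R `^ (q / 2)) => t u v.
by move: ((2 * m.+1%:R)^-1) => s; rewrite !mulrA.
Qed.

End Independence.

(** * Mixed norms and Minkowski's integral inequality *)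


Lemma le_poweR {R : realType} (x y : \bar R) (r : R) : 0 <= r ->
  (0 <= x)%E -> (x <= y)%E -> (poweR x r <= poweR y r)%E.
Proof.
move=> r0 x0 xy; apply: gt0_ler_poweR => //; rewrite in_itv/= leey andbT//.
exact: le_trans xy.
Qed.

Section MinkowskiIntegral.
Context {R : realType} {d1 d2 : measure_display}
  {T1 : measurableType d1} {T2 : measurableType d2}.
Variables (m1 : {sigma_finite_measure set T1 -> \bar R})
  (m2 : {sigma_finite_measure set T2 -> \bar R}).
Local Open Scope ereal_scope.

(* Hoelder on T2 with the weight f(y) = ||F(., y)||_r:
   F = (F f^((1-r)/r)) f^((r-1)/r), and the factors f vanish only where
   F(., y) = 0 almost everywhere. *)
Lemma minkowski_integral (F : T1 * T2 -> R) (r : R) : (1 <= r)%R ->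
  measurable_fun setT F -> (forall z, 0 <= F z)%R ->
  \int[m1]_x ((\int[m2]_y (F (x, y))%:E) `^ r) <=
  (\int[m2]_y ((\int[m1]_x (F (x, y) `^ r)%:E) `^ r^-1)) `^ r.
Proof.
move=> r1 mF F0.
have mFE : measurable_fun setT (EFin \o F) by exact/measurable_EFinP.
(* At r = 1 there is no finite conjugate exponent r/(r-1); both sides then agree by Tonelli. *)
have [->|rN1] := eqVneq r 1%R.
  have -> : \int[m1]_x ((\int[m2]_y (F (x, y))%:E) `^ 1) =
      \int[m1]_x \int[m2]_y (F (x, y))%:E.
    by apply: eq_integral => x _; rewrite poweRe1// integral_ge0// => y _; rewrite lee_fin.
  rewrite (fubini_tonelli (EFin \o F))//= poweRe1; last first.
    by apply: integral_ge0 => y _; exact: poweR_ge0.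
  rewrite le_eqVlt; apply/orP; left; apply/eqP; apply: eq_integral => y _.
  rewrite invr1 poweRe1; last by apply: integral_ge0 => x _; rewrite lee_fin powR_ge0.
  by apply: eq_integral => x _; rewrite powRr1.
have r_gt1 : (1 < r)%R by rewrite lt_neqAle eq_sym rN1.
have r0 : (0 < r)%R by lra.
have rm0 : (0 < r - 1)%R by lra.
have mFr : measurable_fun setT (fun z => (F z `^ r)%:E).
  by apply/measurable_EFinP; apply: (@measurableT_comp _ _ _ _ _ _ (fun x => x `^ r)%R).
have Fr0 z : 0 <= (F z `^ r)%:E by rewrite lee_fin powR_ge0.
pose phi y := (\int[m1]_x (F (x, y) `^ r)%:E) `^ r^-1.
have phi0 y : 0 <= phi y by exact: poweR_ge0.
have mphi : measurable_fun setT phi.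
  apply: (@measurableT_comp _ _ _ _ _ _ (fun x => poweR x r^-1)).
    exact: measurable_poweR.
  exact: (measurable_fun_fubini_tonelli_G (fun z => (F z `^ r)%:E)).
rewrite -/(phi _).
have [Ty|Tfin] := eqVneq (\int[m2]_y phi y) +oo.
  by rewrite Ty poweRyr ?gt_eqF// leey.
have iphi : m2.-integrable setT phi.
  apply/integrableP; split => //.
  by under eq_integral do rewrite gee0_abs//; rewrite ltey.
pose f y := fine (phi y).
have f0 y : (0 <= f y)%R by rewrite fine_ge0.
have mf : measurable_fun setT f by exact: (measurableT_comp (fine_measurable measurableT)).
have aephi : {ae m2, forall y, phi y = (f y)%:E}.
  apply: filterS (integrable_ae measurableT iphi) => y /(_ I) h.
  by rewrite /f fineK.
have intf : \int[m2]_y (f y)%:E = \int[m2]_y phi y.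
  apply: ge0_ae_eq_integral => //; first exact/measurable_EFinP.
    by move=> y _; rewrite lee_fin.
  by apply: filterS aephi => y -> _.
have rr : (r - 1 != 0)%R by rewrite gt_eqF.
have rr1 : (1 - r != 0)%R by rewrite lt_eqF//; lra.
have a1 : ((1 - r) / r != 0)%R by rewrite mulf_neq0// invr_neq0// gt_eqF.
pose h x y := (F (x, y) * f y `^ ((1 - r) / r))%R.
pose g y := (f y `^ ((r - 1) / r))%R.
pose F1 z := (F z * (f z.2 == 0%R)%:R)%R.
(* By convention 0 to a nonzero power is 0, so [h] vanishes where [f] does; [F1] restores F
   there. *)
have FE x y : F (x, y) = (h x y * g y + F1 (x, y))%R.
  rewrite /h /g /F1/=; have [->|fy] := eqVneq (f y) 0%R.
    by rewrite (powR0 a1) mulr0 mul0r add0r mulr1.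
  rewrite mulr0 addr0 -mulrA -powRD; last by rewrite fy implybT.
  by rewrite -mulrDl addrC subrKA subrr mul0r powRr0 mulr1.
have F10 z : (0 <= F1 z)%R by rewrite mulr_ge0.
have mpow a : measurable_fun setT (fun y => f y `^ a)%R.
  by apply: (@measurableT_comp _ _ _ _ _ _ (fun x => x `^ a)%R).
have mF1 : measurable_fun setT (EFin \o F1).
  apply/measurable_EFinP; apply: measurable_funM => //.
  have -> : (fun z : T1 * T2 => (f z.2 == 0%R)%:R : R) =
     (\1_(f @^-1` [set 0%R]) : T2 -> R) \o snd.
    apply/funext => z /=; rewrite indicE; congr (_%:R); congr nat_of_bool.
    by apply/eqP/idP => [h0|]; rewrite inE.
  apply: measurableT_comp => //; apply: measurable_indic.
  by rewrite -[X in measurable X]setTI; exact: mf.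
(* After exchanging the integrals: for almost every y with f(y) = 0 the L^r norm of F(., y) is zero,
   hence F(., y) is zero almost everywhere. *)
have F1ae : {ae m1, forall x, \int[m2]_y (F1 (x, y))%:E = 0}.
  have mI : measurable_fun setT (fun x => \int[m2]_y (F1 (x, y))%:E).
    exact: (measurable_fun_fubini_tonelli_F (EFin \o F1)).
  have : \int[m1]_x `| \int[m2]_y (F1 (x, y))%:E | = 0.
    under eq_integral.
      move=> x _; rewrite gee0_abs; last by apply: integral_ge0 => y _; rewrite lee_fin.
      over.
    rewrite (fubini_tonelli (EFin \o F1))//.
    have -> : 0 = \int[m2]_y (cst 0 y) :> \bar R by rewrite integral0.
    apply: ge0_ae_eq_integral => //.
    - exact: (measurable_fun_fubini_tonelli_G (EFin \o F1)).
    - by move=> y _; apply: integral_ge0 => x _; rewrite lee_fin.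
    apply: filterS aephi => y phiy _ /=.
    rewrite /F1/=; have [fy|fy] := eqVneq (f y) 0%R; last first.
      by under eq_integral do rewrite mulr0; rewrite integral0.
    under eq_integral do rewrite mulr1.
    rewrite fy in phiy.
    have mFy : measurable_fun setT (fun x => (F (x, y))%:E).
      exact: (measurableT_comp mFE).
    have : \int[m1]_x `|(F (x, y) `^ r)%:E| = 0.
      under eq_integral do rewrite gee0_abs//.
      apply: (@poweR_eq0_eq0 _ _ r^-1) => //.
      exact: integral_ge0.
    have mFyr : measurable_fun setT (fun x => (F (x, y) `^ r)%:E).
      exact: (measurableT_comp mFr).
    move/(ae_eq_integral_abs m1 measurableT mFyr) => aeF.
    have -> : 0 = \int[m1]_x (cst 0 x) :> \bar R by rewrite integral0.
    apply: ge0_ae_eq_integral => //.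
      by move=> x _; rewrite lee_fin.
    apply: filterS aeF => x /(_ I)/= [] /eqP; rewrite powR_eq0.
    by move=> /andP[/eqP -> _] _.
  move/(ae_eq_integral_abs m1 measurableT mI).
  by apply: filterS => x /(_ I).
have mh x : measurable_fun setT (h x).
  by apply: measurable_funM => //; apply/measurable_EFinP; exact: (measurableT_comp mFE).
have h0 x y : (0 <= h x y)%R by rewrite mulr_ge0 ?powR_ge0.
have g0 y : (0 <= g y)%R by rewrite powR_ge0.
pose r' := (r / (r - 1))%R.
have r'0 : (0 < r')%R by rewrite divr_gt0.
have intf0 : 0 <= \int[m2]_y (f y)%:E by apply: integral_ge0 => y _; rewrite lee_fin.
have hoelderx x : (\int[m2]_y (h x y * g y)%:E) `^ r <=
    (\int[m2]_y (h x y `^ r)%:E) * (\int[m2]_y (f y)%:E) `^ (r - 1).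
  have := @hoelder _ _ _ m2 (h x) g r r' (mh x) (mpow _) r0 r'0.
  have -> : (r^-1 + r'^-1 = 1)%R.
    by rewrite /r'; field; rewrite rr gt_eqF.
  move=> /(_ erefl) /(le_poweR (ltW r0)) => /(_ (Lnorm_ge0 _ _ _)).
  rewrite poweRM ?Lnorm_ge0// poweR_Lnorm ?gt_eqF// Lnorm1.
  have -> : \int[m2]_y `|(EFin \o (h x \* g)%R) y| = \int[m2]_y (h x y * g y)%:E.
    by apply: eq_integral => y _; rewrite gee0_abs// lee_fin mulr_ge0.
  move=> /le_trans; apply.
  rewrite le_eqVlt; apply/orP; left; apply/eqP; congr (_ * _).
    by apply: eq_integral => y _; rewrite gee0_abs ?lee_fin.
  rewrite unlock -poweRrM; congr (poweR _ _).
    apply: eq_integral => y _; rewrite gee0_abs ?lee_fin// poweR_EFin /g -powRrM.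
    have -> : ((r - 1) / r * r' = 1)%R by rewrite /r'; field; rewrite rr gt_eqF.
    by rewrite powRr1.
  by rewrite /r'; field; rewrite rr gt_eqF.
have mhr : measurable_fun setT (fun z => (h z.1 z.2 `^ r)%:E).
  apply/measurable_EFinP; apply: (@measurableT_comp _ _ _ _ _ _ (fun x => x `^ r)%R) => //.
  rewrite /h; apply: measurable_funM; last exact: (measurableT_comp (mpow _)).
  by under eq_fun do rewrite -surjective_pairing.
apply: (@le_trans _ _ (\int[m1]_x ((\int[m2]_y (h x y `^ r)%:E) *
    (\int[m2]_y (f y)%:E) `^ (r - 1)))).
  apply: ae_ge0_le_integral => //.
  - by move=> x _; exact: poweR_ge0.
  - apply: (@measurableT_comp _ _ _ _ _ _ (fun x => poweR x r)).
      exact: measurable_poweR.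
    exact: (measurable_fun_fubini_tonelli_F (EFin \o F)).
  - move=> x _; apply: mule_ge0; last exact: poweR_ge0.
    by apply: integral_ge0 => y _; rewrite lee_fin powR_ge0.
  - apply: emeasurable_funM => //.
    by apply: (measurable_fun_fubini_tonelli_F (fun z => (h z.1 z.2 `^ r)%:E)) => // z; rewrite lee_fin powR_ge0.
  apply: filterS F1ae => x Fx _; apply: le_trans (hoelderx x).
  rewrite le_eqVlt; apply/orP; left; apply/eqP; congr (poweR _ _).
  under eq_integral do rewrite FE EFinD.
  rewrite ge0_integralD//= ?Fx ?adde0//.
  - by move=> y _; rewrite lee_fin mulr_ge0.
  - apply/measurable_EFinP; apply: measurable_funM => //; exact: mpow.
  - by move=> y _; rewrite lee_fin.
  - exact: (measurableT_comp mF1).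
rewrite ge0_integralZr//; last 3 first.
- by apply: (measurable_fun_fubini_tonelli_F (fun z => (h z.1 z.2 `^ r)%:E)) => // z; rewrite lee_fin powR_ge0.
- by move=> x _; apply: integral_ge0 => y _; rewrite lee_fin powR_ge0.
- exact: poweR_ge0.
rewrite (fubini_tonelli (fun z => (h z.1 z.2 `^ r)%:E))//=; last first.
  by move=> z; rewrite lee_fin powR_ge0.
(* Where f is positive the inner integral is f^(1-r) f^r = f; this is why the weight has the
   exponent (1-r)/r. *)
have -> : \int[m2]_y \int[m1]_x (h x y `^ r)%:E = \int[m2]_y (f y)%:E.
  apply: ge0_ae_eq_integral => //.
  - by apply: (measurable_fun_fubini_tonelli_G (fun z => (h z.1 z.2 `^ r)%:E)) => // z; rewrite lee_fin powR_ge0.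
  - exact/measurable_EFinP.
  - by move=> y _; apply: integral_ge0 => x _; rewrite lee_fin powR_ge0.
  - by move=> y _; rewrite lee_fin.
  apply: filterS aephi => y phiy _.
  have E1 : \int[m1]_x (F (x, y) `^ r)%:E = (f y `^ r)%:E.
    rewrite -poweR_EFin -phiy /phi -poweRrM mulVf ?gt_eqF// poweRe1//.
    by apply: integral_ge0.
  under eq_integral.
    move=> x _; rewrite /h powRM ?powR_ge0// -powRrM.
    have -> : ((1 - r) / r * r = 1 - r)%R by rewrite divfK// gt_eqF.
    rewrite mulrC EFinM; over.
  rewrite ge0_integralZl//=; last 2 first.
    exact: (measurableT_comp mFr).
  - by rewrite lee_fin powR_ge0.
  rewrite E1 -EFinM; congr EFin.
  have [->|fy] := eqVneq (f y) 0%R.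
    by rewrite (powR0 rr1) mul0r.
  rewrite -powRD ?fy ?implybT//.
  by rewrite subrK powRr1.
rewrite intf -{1}[\int[m2]_y phi y]poweRe1; last exact: integral_ge0.
rewrite -poweRD; last first.
  by apply: add_neq0_poweRD_def; rewrite addrC subrK gt_eqF.
by rewrite addrC subrK.
Qed.

End MinkowskiIntegral.

Section MixedNorms.
Context {R : realType} {dO dS : measure_display}
  {Om : measurableType dO} {S : measurableType dS}.
Variables (P : probability Om R) (mu : {sigma_finite_measure set S -> \bar R}).
Implicit Types (Y Z : Om -> S -> R) (f : S -> R) (p q : R).
Local Open Scope ereal_scope.

Lemma measurable_joint1 Y w : measurable_fun setT (fun z => Y z.1 z.2) ->
  measurable_fun setT (Y w).
Proof. by move=> mY; exact: (measurableT_comp mY (pair1_measurable w)). Qed.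

Lemma measurable_joint2 Y s : measurable_fun setT (fun z => Y z.1 z.2) ->
  measurable_fun setT (fun w => Y w s).
Proof. by move=> mY; exact: (measurableT_comp mY (pair2_measurable s)). Qed.

Lemma integral_normr_powR_ge0 d (T : measurableType d) (m : {measure set T -> \bar R})
  (D : set T) (g : T -> R) r : 0 <= \int[m]_(x in D) (`|g x| `^ r)%:E.
Proof. by apply: integral_ge0 => x _; rewrite lee_fin powR_ge0. Qed.

Lemma normLpSE p f : normLpS mu p f = (\int[mu]_s (`|f s| `^ p)%:E) `^ p^-1.
Proof. by rewrite /normLpS unlock. Qed.

Lemma normLpS_ge0 p f : 0 <= normLpS mu p f. Proof. exact: Lnorm_ge0. Qed.

Lemma normLpS_lty p f : (0 < p)%R ->
  (normLpS mu p f < +oo) = (\int[mu]_s (`|f s| `^ p)%:E < +oo).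
Proof.
move=> p0; rewrite normLpSE; apply/idP/idP; last exact: poweR_lty.
by apply: lty_poweRy; rewrite invr_neq0// gt_eqF.
Qed.

Lemma measurable_normLpS p Y : measurable_fun setT (fun z => Y z.1 z.2) ->
  measurable_fun setT (fun w => normLpS mu p (Y w)).
Proof.
move=> mY; under eq_fun do rewrite normLpSE.
apply: (@measurableT_comp _ _ _ _ _ _ (fun x => poweR x p^-1)).
  exact: measurable_poweR.
by apply: (measurable_fun_fubini_tonelli_F (fun z => (`|Y z.1 z.2| `^ p)%:E));
  [exact: measurable_normr_powR|move=> z; rewrite lee_fin powR_ge0].
Qed.

Lemma normLqLpE q p Y : normLqLp P mu q p Y =
  (\int[P]_w ((\int[mu]_s (`|Y w s| `^ p)%:E) `^ (q / p))) `^ q^-1.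
Proof.
rewrite /normLqLp; congr (poweR _ _); apply: eq_integral => w _.
by rewrite normLpSE -poweRrM mulrC.
Qed.

Lemma normLpLqE p q Y : normLpLq P mu p q Y =
  (\int[mu]_s ((\int[P]_w (`|Y w s| `^ q)%:E) `^ (p / q))) `^ p^-1.
Proof.
rewrite /normLpLq; congr (poweR _ _); apply: eq_integral => s _.
by rewrite unlock -poweRrM mulrC.
Qed.

(** This is [minkowski_integral] for |Y|^p with r = q/p, followed by a q-th root. *)
Lemma normLqLp_le_normLpLq q p Y : (1 <= p)%R -> (p <= q)%R ->
  measurable_fun setT (fun z => Y z.1 z.2) ->
  normLqLp P mu q p Y <= normLpLq P mu p q Y.
Proof.
move=> p1 pq mY; have p0 : (0 < p)%R by lra.
have q0 : (0 < q)%R by lra.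
have r1 : (1 <= q / p)%R by rewrite ler_pdivlMr// mul1r.
have mF : measurable_fun setT (fun z : Om * S => `|Y z.1 z.2| `^ p)%R.
  exact/measurable_EFinP/measurable_normr_powR.
have := @minkowski_integral _ _ _ _ _ P mu _ _ r1 mF (fun z => powR_ge0 _ _).
rewrite /= => H.
have qi0 : (0 <= q^-1)%R by rewrite invr_ge0 ltW.
rewrite normLqLpE; apply: (le_trans (le_poweR qi0 _ H)).
  by apply: integral_ge0 => w _; exact: poweR_ge0.
rewrite -poweRrM normLpLqE le_eqVlt; apply/orP; left; apply/eqP.
have -> : (q / p * q^-1 = p^-1)%R by rewrite mulrAC mulfV ?mul1r ?gt_eqF.
congr (poweR _ _); apply: eq_integral => s _.
rewrite invf_div; congr (poweR _ _); apply: eq_integral => w _.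
by rewrite -powRrM mulrCA mulfV ?mulr1 ?gt_eqF.
Qed.

Lemma normLqLp_cst q p f : (0 < q)%R ->
  normLqLp P mu q p (fun _ => f) = normLpS mu p f.
Proof.
move=> q0; rewrite /normLqLp integral_cst_probability -poweRrM mulfV ?gt_eqF//.
by rewrite poweRe1// normLpS_ge0.
Qed.

Lemma normLqLp_ge0 q p Y : 0 <= normLqLp P mu q p Y.
Proof. exact: poweR_ge0. Qed.

Lemma normLqLp_lty q p Y : (0 < q)%R -> normLqLp P mu q p Y < +oo ->
  measurable_fun setT (fun z => Y z.1 z.2) ->
  {ae P, forall w, normLpS mu p (Y w) < +oo}.
Proof.
move=> q0 h mY; have qi : (q^-1 != 0)%R by rewrite invr_neq0// gt_eqF.
have i : P.-integrable setT (fun w => normLpS mu p (Y w) `^ q).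
  apply/integrableP; split.
    apply: (@measurableT_comp _ _ _ _ _ _ (fun x => poweR x q)).
      exact: measurable_poweR.
    exact: measurable_normLpS.
  under eq_integral do rewrite gee0_abs ?poweR_ge0//.
  exact: (lty_poweRy qi h).
apply: filterS (integrable_ae measurableT i) => w /(_ I).
rewrite ge0_fin_numE ?poweR_ge0//.
by apply: lty_poweRy; rewrite gt_eqF.
Qed.

(** Minkowski twice, in s and then in w. The infinite cases are removed first, so that the inner
    norms are almost surely finite and may be replaced by the real functions to which Minkowski's
    inequality over P applies. *)
Lemma normLqLp_triangle q p Y Z : (1 <= p)%R -> (1 <= q)%R ->
  measurable_fun setT (fun z => Y z.1 z.2) ->
  measurable_fun setT (fun z => Z z.1 z.2) ->
  normLqLp P mu q p (fun w s => Y w s + Z w s)%R <=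
  normLqLp P mu q p Y + normLqLp P mu q p Z.
Proof.
move=> p1 q1 mY mZ; have q0 : (0 < q)%R by lra.
have [Yy|Yfin] := eqVneq (normLqLp P mu q p Y) +oo.
  by rewrite Yy addye ?leey// -ltNye (lt_le_trans _ (normLqLp_ge0 _ _ _)).
have [Zy|Zfin] := eqVneq (normLqLp P mu q p Z) +oo.
  by rewrite Zy addey ?leey// -ltNye (lt_le_trans _ (normLqLp_ge0 _ _ _)).
have mYZ : measurable_fun setT (fun z : Om * S => Y z.1 z.2 + Z z.1 z.2)%R.
  exact: measurable_funD.
have aeY := normLqLp_lty q0 (_ : normLqLp P mu q p Y < +oo) mY.
have aeZ := normLqLp_lty q0 (_ : normLqLp P mu q p Z < +oo) mZ.
rewrite !ltey in aeY aeZ; move: (aeY Yfin) (aeZ Zfin) => {}aeY {}aeZ.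
pose u w := fine (normLpS mu p (Y w)); pose v w := fine (normLpS mu p (Z w)).
have u0 w : (0 <= u w)%R by rewrite fine_ge0// normLpS_ge0.
have v0 w : (0 <= v w)%R by rewrite fine_ge0// normLpS_ge0.
have mu_ : measurable_fun setT u.
  by apply: (measurableT_comp (fine_measurable measurableT)); exact: measurable_normLpS.
have mv : measurable_fun setT v.
  by apply: (measurableT_comp (fine_measurable measurableT)); exact: measurable_normLpS.
have qi0 : (0 <= q^-1)%R by rewrite invr_ge0 ltW.
have NE (W : Om -> S -> R) (mW : measurable_fun setT (fun z => W z.1 z.2)) :
    {ae P, forall w, normLpS mu p (W w) < +oo} ->
    normLqLp P mu q p W = 'N[P]_q%:E[EFin \o (fun w => fine (normLpS mu p (W w)))].
  move=> aeW; rewrite /normLqLp unlock; congr (poweR _ _).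
  have mN := measurable_normLpS p mW.
  apply: ge0_ae_eq_integral => //.
  - apply: (@measurableT_comp _ _ _ _ _ _ (fun x => poweR x q)) => //.
    exact: measurable_poweR.
  - apply: measurable_normr_powR.
    exact: (measurableT_comp (fine_measurable measurableT)).
  - by move=> w _; exact: poweR_ge0.
  - by move=> w _; exact: poweR_ge0.
  apply: filterS aeW => w Ww _ /=.
  rewrite -[in LHS](@fineK _ (normLpS mu p (W w))) ?ge0_fin_numE ?normLpS_ge0//.
  by rewrite poweR_EFin ger0_norm// fine_ge0// normLpS_ge0.
rewrite (NE _ mY aeY) (NE _ mZ aeZ).
apply: le_trans (minkowski_EFin P mu_ mv q1).
rewrite /normLqLp unlock; apply: le_poweR => //.
  by apply: integral_ge0 => w _; exact: poweR_ge0.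
apply: ae_ge0_le_integral => //.
- by move=> w _; exact: poweR_ge0.
- apply: (@measurableT_comp _ _ _ _ _ _ (fun x => poweR x q)).
    exact: measurable_poweR.
  exact: (@measurable_normLpS p (fun w s => Y w s + Z w s)%R).
- by move=> w _; exact: poweR_ge0.
- by apply: measurable_normr_powR; exact: measurable_funD.
apply: filterS2 aeY aeZ => w Yw Zw _ /=.
rewrite -poweR_EFin; apply: le_poweR; [exact: ltW|exact: normLpS_ge0|].
rewrite ger0_norm ?addr_ge0// EFinD /u /v !fineK ?ge0_fin_numE ?normLpS_ge0//.
exact: (@minkowski_EFin _ _ _ mu (Y w) (Z w) p (measurable_joint1 w mY) (measurable_joint1 w mZ)).
Qed.

(** The tangent inequality of t^p at c, integrated over B, is [key]; the best c is the mean of |f|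
    over B. *)
Lemma jensen_average p f (B : set S) : (1 <= p)%R -> measurable_fun setT f ->
  measurable B -> 0 < mu B -> mu B < +oo ->
  (`|(fine (mu B))^-1 * fine (\int[mu]_(s in B) (f s)%:E)| `^ p)%:E * mu B <=
  \int[mu]_(s in B) (`|f s| `^ p)%:E.
Proof.
move=> p1 mf mB B0 By; have p0 : (0 < p)%R by lra.
have [->|Ify] := eqVneq (\int[mu]_(s in B) (`|f s| `^ p)%:E) +oo; first by rewrite leey.
have mfB : measurable_fun B f by exact: measurable_funS mf.
have mfpB : measurable_fun B (fun s => (`|f s| `^ p)%:E).
  by apply: measurable_funS (measurable_normr_powR p mf).
have mnB : measurable_fun B (fun s => `|f s|%:E).
  by apply/measurable_EFinP; exact: measurableT_comp.
pose b := fine (mu B).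
have bE : mu B = b%:E by rewrite fineK// gt0_fin_numE.
have b0 : (0 < b)%R by rewrite fine_gt0// B0.
set J := \int[mu]_(s in B) (`|f s| `^ p)%:E in Ify *.
have J0 : 0 <= J by exact: integral_normr_powR_ge0.
pose j := fine J.
have JE : J = j%:E by rewrite fineK// ge0_fin_numE// ltey.
have key (c : R) : (0 <= c)%R ->
    (p * c `^ (p - 1))%:E * \int[mu]_(s in B) `|f s|%:E <=
    (j + (p - 1) * c `^ p * b)%:E.
  move=> c0; rewrite EFinD (EFinM _ b) -bE -JE.
  have -> : ((p - 1) * c `^ p)%:E * mu B = \int[mu]_(s in B) ((p - 1) * c `^ p)%:E.
    by rewrite integral_cst.
  rewrite -ge0_integralZl//=; last by rewrite lee_fin mulr_ge0 ?powR_ge0// ltW.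
  rewrite -ge0_integralD//=; last first.
    by move=> s _; rewrite lee_fin mulr_ge0 ?powR_ge0//; lra.
  apply: ge0_le_integral => //.
  - by move=> s _; rewrite -EFinM lee_fin !mulr_ge0 ?powR_ge0// ltW.
  - exact: measurable_funeM.
  - exact: emeasurable_funD.
  move=> s _; rewrite -EFinM -EFinD lee_fin.
  have := powR_tangent p1 (normr_ge0 (f s)) c0.
  by rewrite -(mulr_powRB1 c0 p0); lra.
(* The tangent at 1 already shows that |f| is integrable on B, so the mean used next is finite. *)
have Iny : \int[mu]_(s in B) `|f s|%:E != +oo.
  apply/eqP => h; have := key 1%R ler01.
  by rewrite h powR1 mulr1 gt0_muley ?lte_fin// leye_eq.
have In0 : 0 <= \int[mu]_(s in B) `|f s|%:E by apply: integral_ge0.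
pose i := fine (\int[mu]_(s in B) `|f s|%:E).
have IE : \int[mu]_(s in B) `|f s|%:E = i%:E.
  by rewrite fineK// ge0_fin_numE// ltey.
have i0 : (0 <= i)%R by rewrite fine_ge0.
have ib0 : (0 <= i / b)%R by rewrite divr_ge0// ltW.
have absI : (`|fine (\int[mu]_(s in B) (f s)%:E)| <= i)%R.
  have ffin : \int[mu]_(s in B) (f s)%:E \is a fin_num.
    by rewrite -integral_fin_num_abs//= IE ltry.
  have := le_abse_integral mu mB (_ : measurable_fun B (EFin \o f)).
  move=> /(_ ltac:(exact/measurable_EFinP)).
  by rewrite -lee_fin -abse_EFin fineK//= IE.
have := key _ ib0; rewrite IE bE JE -!EFinM !lee_fin => H.
have iE : i = (i / b * b)%R by rewrite divfK// gt_eqF.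
have {}H : ((i / b) `^ p * b <= j)%R.
  have E : (p * (i / b) `^ (p - 1) * i = p * ((i / b) `^ p * b))%R.
    by rewrite -(mulr_powRB1 ib0 p0) {2}iE; ring.
  by move: H; rewrite E; lra.
apply: le_trans H; apply: ler_wpM2r; first exact: ltW.
apply: ge0_ler_powR; rewrite ?nnegrE//; first exact: ltW.
rewrite /= normrM mulrC [`|b^-1|%R]ger0_norm ?invr_ge0 ?(ltW b0)//.
by rewrite ler_wpM2r// invr_ge0 ltW.
Qed.

End MixedNorms.

(** * Averaging operators *)


Section Averaging.
Context {R : realType} {dS : measure_display} {S : measurableType dS}.
Variable mu : {measure set S -> \bar R}.
Implicit Types (p : R) (f : S -> R).
Import HBSimple.

(** On a set of finite measure, |f| <= 1 + |f|^p suffices. *)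
Lemma integrable_powR p f (B : set S) : 1 <= p -> measurable_fun setT f ->
  measurable B -> (mu B < +oo)%E ->
  (\int[mu]_(s in B) (`|f s| `^ p)%:E < +oo)%E -> mu.-integrable B (EFin \o f).
Proof.
move=> p1 mf mB By Ify.
have mfB : measurable_fun B f by exact: measurable_funS mf.
have mpB : measurable_fun B (fun s => (`|f s| `^ p)%:E).
  by apply: measurable_funS (measurable_normr_powR p mf).
have Ip : mu.-integrable B (fun s => (`|f s| `^ p)%:E).
  apply/integrableP; split => //.
  by under eq_integral do rewrite gee0_abs ?lee_fin ?powR_ge0//.
have I1 : mu.-integrable B (EFin \o cst 1).
  apply/integrableP; split; first exact/measurable_EFinP/measurable_cst.
  under eq_integral do rewrite /= normr1.
  by rewrite integral_cst// mul1e.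
apply: le_integrable (integrableD mB I1 Ip) => //.
  exact/measurable_EFinP.
move=> s _; rewrite /= lee_fin [leRHS]ger0_norm ?addr_ge0 ?powR_ge0//.
exact: le_add1_powR.
Qed.

Lemma sfun_simple_eval (g : {sfun S >-> R}) :
  exists (k : nat) (A : nat -> set S) (v : nat -> R),
  (forall i, measurable (A i)) /\ forall s, simple_eval k A v s = g s.
Proof.
pose l : seq R := finmap.enum_fset (fset_set (range g)).
exists (size l), (fun i => g @^-1` [set l`_i]), (fun i => l`_i).
split => [i|s]; first exact: measurable_sfunP.
by rewrite fimfunEord /simple_eval; apply: eq_bigr => i _; rewrite mulrC.
Qed.

Lemma strongly_measurable_real f : measurable_fun setT f ->
  strongly_measurable mu (f : S -> R).
Proof.
move=> mf.
have mfE : measurable_fun setT (EFin \o f) by exact/measurable_EFinP.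
have [g gf] := approximation_sfun measurableT mfE.
have H n := sfun_simple_eval (g n).
pose k n := projT1 (cid (H n)).
pose A n := projT1 (cid (projT2 (cid (H n)))).
pose v n := projT1 (cid (projT2 (cid (projT2 (cid (H n)))))).
have Hn n : (forall i, measurable (A n i)) /\
    forall s, simple_eval (k n) (A n) (v n) s = g n s.
  exact: (projT2 (cid (projT2 (cid (projT2 (cid (H n))))))).
exists k, A, v; split; first by move=> n i; exact: (Hn n).1.
apply/nearW => s; under eq_fun do rewrite (Hn _).2.
by have := gf s I; move=> /fine_cvgP[].
Qed.

Lemma integral_simple_eval (k : nat) (A : nat -> set S) (v : nat -> R) (B : set S) :
  measurable B -> (mu B < +oo)%E -> (forall i, measurable (A i)) ->
  (\int[mu]_(s in B) (simple_eval k A v s)%:E =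
   (\sum_(i < k) fine (mu (A i `&` B)) *: v i)%:E)%E.
Proof.
move=> mB By mA.
have AB i : (mu (A i `&` B) < +oo)%E.
  by apply: le_lt_trans By; apply: le_measure; rewrite ?inE//; exact: measurableI.
have I1 i : mu.-integrable B (EFin \o (\1_(A i) : S -> R)).
  by apply/integrableP; split;
    [exact/measurable_EFinP/measurable_indic
    |under eq_integral do rewrite /= ger0_norm//; rewrite integral_indic].
have Ii i : mu.-integrable B (fun s => (v i)%:E * (\1_(A i) s : R)%:E)%E.
  exact: (integrableZl mB (v i) (I1 i)).
transitivity (\int[mu]_(s in B) (\sum_(i < k) (v i)%:E * (\1_(A i) s : R)%:E))%E.
  by apply: eq_integral => s _; rewrite /simple_eval -sumEFin; apply: eq_bigr => i _;
    rewrite -EFinM mulrC.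
rewrite integral_sum//= -sumEFin; apply: eq_bigr => i _.
rewrite (integralZl mB (I1 i)) [X in (_ * X)%E](integral_indic _ mB (mA i)).
by rewrite EFinM fineK ?ge0_fin_numE// muleC.
Qed.

(** Identifies the Bochner integral with the Lebesgue integral for real functions, so that the
    averaging property can be fed with [fine] of integrals. The approximants converge in L^1(B), and
    their integrals differ from that of f by at most the L^1(B) distance. *)
Lemma bochner_integral_is_real f (B : set S) : measurable_fun setT f ->
  measurable B -> (mu B < +oo)%E -> mu.-integrable B (EFin \o f) ->
  bochner_integral_is mu B f (fine (\int[mu]_(s in B) (f s)%:E)).
Proof.
move=> mf mB By If; split; first exact: strongly_measurable_real.
have [g [Ig _ gf]] := approximation_sfun_integrable mB If.
have H n := sfun_simple_eval (g n).
pose k n := projT1 (cid (H n)).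
pose A n := projT1 (cid (projT2 (cid (H n)))).
pose v n := projT1 (cid (projT2 (cid (projT2 (cid (H n)))))).
have Hn n : (forall i, measurable (A n i)) /\
    forall s, simple_eval (k n) (A n) (v n) s = g n s.
  exact: (projT2 (cid (projT2 (cid (projT2 (cid (H n))))))).
have mA n i : measurable (A n i) by exact: (Hn n).1.
have gf' : (fun n => \int[mu]_(s in B)
    (`|simple_eval (k n) (A n) (v n) s - f s|)%:E)%E @ \oo --> 0%E.
  apply: cvg_trans gf; apply: near_eq_cvg; near=> n.
  apply: eq_integral => s _; by rewrite (Hn n).2 distrC.
exists k, A, v; split; [|split => //].
  move=> n i; split => //; apply: le_lt_trans By.
  by apply: le_measure; rewrite ?inE//; exact: measurableI.
have E n : \sum_(i < k n) fine (mu (A n i `&` B)) *: v n i =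
    fine (\int[mu]_(s in B) (g n s)%:E)%E.
  have := integral_simple_eval (k n) (v n) mB By (mA n).
  by under eq_integral do rewrite (Hn n).2; move=> ->.
under eq_fun do rewrite E.
have Ifin : (\int[mu]_(s in B) (f s)%:E)%E \is a fin_num by exact: integrable_fin_num.
have Igfin n : (\int[mu]_(s in B) (g n s)%:E)%E \is a fin_num.
  by apply: integrable_fin_num => //; exact: Ig.
move/fine_cvgP : (gf) => [_ /cvgrPdist_le h].
apply/cvgrPdist_le => e e0; apply: filterS (h e e0) => n; apply: le_trans.
have Idn : mu.-integrable B (fun s => (f s)%:E - (g n s)%:E)%E.
  exact: (integrableB mB If (Ig n)).
have dfin : (\int[mu]_(s in B) `|(f s)%:E - (g n s)%:E|)%E \is a fin_num.
  by apply: integrable_fin_num => //; exact: integrable_abse.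
rewrite /= sub0r normrN [leRHS]ger0_norm; last first.
  by rewrite fine_ge0// integral_ge0.
rewrite -fineB// -integralB_EFin// -lee_fin -abse_EFin !fineK//; last first.
  by apply: integrable_fin_num.
by apply: le_abse_integral => //; exact: measurable_int Idn.
Unshelve. all: by end_near. Qed.

End Averaging.

(** * Step functions on a countable family of disjoint blocks *)

Section StepFunctions.
Context {R : realType} {dS : measure_display} {S : measurableType dS}.
Implicit Types (K : set nat) (B : nat -> set S) (c : nat -> R).

(* The index is chosen: [step] is meaningful only when the [B k] with [K k] are
   disjoint. *)
Definition step K B c (s : S) : R :=
  if pselect (exists k, K k /\ B k s) is left H then c (projT1 (cid H)) else 0.

(** Empty at indices outside K, so that a finite or countable family becomes a disjoint sequence
    indexed by all of [nat], as countable unions and series require. *)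
Definition restricted K B (k : nat) : set S := [set s | K k /\ B k s].

Lemma step_in K B c k s :
  (forall i j, K i -> K j -> i <> j -> B i `&` B j = set0) ->
  K k -> B k s -> step K B c s = c k.
Proof.
move=> dB Kk Bk; rewrite /step; case: pselect => [H|]; last by case; exists k.
case: (cid H) => j [Kj Bj] /=; congr c; apply: contrapT => jk.
suff : (B j `&` B k) s by rewrite dB.
by split.
Qed.

Lemma step_out K B c s : (forall k, K k -> ~ B k s) -> step K B c s = 0.
Proof.
by move=> h; rewrite /step; case: pselect => // -[k [Kk Bk]]; case: (h k Kk).
Qed.

Lemma measurable_restricted K B k : (forall i, K i -> measurable (B i)) ->
  measurable (restricted K B k).
Proof.
move=> mB; have [Kk|Kk] := pselect (K k).
  have -> : restricted K B k = B k by apply/seteqP; split => s; [case|].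
  exact: mB.
by have -> : restricted K B k = set0 by apply/seteqP; split => s // [].
Qed.

Lemma trivIset_restricted K B :
  (forall i j, K i -> K j -> i <> j -> B i `&` B j = set0) ->
  trivIset setT (restricted K B).
Proof.
move=> dB; apply/trivIsetP => i j _ _ /eqP ij.
apply/seteqP; split => s // [[Ki Bi] [Kj Bj]].
by rewrite -(dB i j Ki Kj ij).
Qed.

(** A preimage is a countable union of rectangles, one per block, together with Omega times the
    complement of the blocks when 0 belongs to U. *)
Lemma measurable_step dO (Om : measurableType dO) K B (C : Om -> nat -> R) :
  (forall i, K i -> measurable (B i)) ->
  (forall i j, K i -> K j -> i <> j -> B i `&` B j = set0) ->
  (forall k, K k -> measurable_fun setT (fun w => C w k)) ->
  measurable_fun setT (fun z : Om * S => step K B (C z.1) z.2).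
Proof.
move=> mB dB mC _ U mU; rewrite setTI.
pose N := ~` \bigcup_k restricted K B k.
have mN : measurable N.
  by apply/measurableC/bigcup_measurable => k _; exact: measurable_restricted.
have -> : (fun z : Om * S => step K B (C z.1) z.2) @^-1` U =
   \bigcup_k (((fun w => C w k) @^-1` U) `*` restricted K B k)
   `|` (if pselect (U 0) is left _ then setT `*` N else set0).
  apply/seteqP; split => -[w s] /=.
    have [[k [Kk Bk]]|H] := pselect (exists k, K k /\ B k s).
      by rewrite (step_in _ dB Kk Bk) => UC; left; exists k.
    have H' k : K k -> ~ B k s by move=> Kk Bk; apply: H; exists k.
    rewrite (step_out _ H') => U0; right; case: pselect => //= _.
    by split => // -[k _ [Kk Bk]]; exact: H' Bk.
  move=> [[k _ [/= UC [Kk Bk]]]|]; first by rewrite (step_in _ dB Kk Bk).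
  case: pselect => //= U0 [_ Ns]; rewrite step_out// => k Kk Bk.
  by apply: Ns; exists k.
apply: measurableU; last by case: pselect => // _; exact: measurableX.
apply: bigcup_measurable => k _; have [Kk|Kk] := pselect (K k); last first.
  by have -> : restricted K B k = set0; [apply/seteqP; split => s // []|rewrite setX0].
apply: measurableX; last exact: measurable_restricted.
by rewrite -[X in measurable X]setTI; exact: mC.
Qed.

Lemma integral_piecewise_le (mu : {measure set S -> \bar R}) (A : nat -> set S)
    (f g : S -> \bar R) :
  (forall k, measurable (A k)) -> trivIset setT A ->
  measurable_fun setT f -> measurable_fun setT g ->
  (forall s, 0 <= f s)%E -> (forall s, 0 <= g s)%E ->
  (forall s, ~ (\bigcup_k A k) s -> f s = 0%E) ->
  (forall k, \int[mu]_(s in A k) f s <= \int[mu]_(s in A k) g s)%E ->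
  (\int[mu]_s f s <= \int[mu]_s g s)%E.
Proof.
move=> mA tA mf mg f0 g0 fA fg.
have mU : measurable (\bigcup_k A k) by exact: bigcup_measurable.
have -> : (\int[mu]_s f s = \int[mu]_(s in \bigcup_k A k) f s)%E.
  rewrite [RHS]integral_mkcond; apply: eq_integral => s _.
  by rewrite patchE; case: ifPn => // /negP h; apply: fA => Us; apply: h; rewrite inE.
apply: (@le_trans _ _ (\int[mu]_(s in \bigcup_k A k) g s)%E); last first.
  exact: ge0_subset_integral.
rewrite !ge0_integral_bigcup//; [|exact: measurable_funS mg|exact: measurable_funS mf].
apply: lee_nneseries => [k _ _|k _]; [exact: integral_ge0|exact: fg].
Qed.

End StepFunctions.

Section AveragingOperator.
Context {R : realType} {dS : measure_display} {S : measurableType dS}.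
Variable mu : {measure set S -> \bar R}.

Definition averages (B : nat -> set S) (f : S -> R) (k : nat) : R :=
  (fine (mu (B k)))^-1 * fine (\int[mu]_(s in B k) (f s)%:E)%E.

(** The property is taken here with its families already chosen, since the same blocks must serve
    all outcomes w and keep the step functions jointly measurable. *)
Lemma averaging_real (K : nat -> set nat) (Bs : nat -> nat -> set S) :
  (forall n k, K n k -> measurable (Bs n k) /\ (0 < mu (Bs n k))%E /\ (mu (Bs n k) < +oo)%E) ->
  (forall n i j, K n i -> K n j -> i <> j -> Bs n i `&` Bs n j = set0) ->
  (forall (E : completeNormedModType R) (p : R), 1 <= p ->
    forall f : S -> E, in_LpE mu p f ->
    forall (v : nat -> nat -> E),
      (forall n k, K n k -> bochner_integral_is mu (Bs n k) f (v n k)) ->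
    forall (g : nat -> S -> E),
      (forall n s,
         (forall k, K n k -> Bs n k s -> g n s = (fine (mu (Bs n k)))^-1 *: v n k) /\
         ((forall k, K n k -> ~ Bs n k s) -> g n s = 0)) ->
      (fun n => (\int[mu]_s ((`|g n s - f s| `^ p)%:E))%E) @ \oo --> 0%E) ->
  forall (p : R) (f : S -> R), 1 <= p -> measurable_fun setT f ->
    (\int[mu]_s ((`|f s| `^ p)%:E) < +oo)%E ->
    (fun n => (\int[mu]_s
       ((`|step (K n) (Bs n) (averages (Bs n) f) s - f s| `^ p)%:E))%E) @ \oo --> 0%E.
Proof.
move=> HB dB H p f p1 mf Ipf.
apply: (H R p p1 f _ (fun n k => fine (\int[mu]_(s in Bs n k) (f s)%:E)%E)).
- by split => //; exact: strongly_measurable_real.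
- move=> n k Kk; have [mB [_ By]] := HB n k Kk; apply: bochner_integral_is_real => //.
  apply: (integrable_powR p1 mf mB By).
  apply: le_lt_trans Ipf; apply: ge0_subset_integral => //.
  exact: measurable_normr_powR.
- move=> n s; split; first by move=> k Kk Bk; rewrite (step_in _ (dB n) Kk Bk).
  exact: step_out.
Qed.

End AveragingOperator.

(** * Block averages of the samples *)


Lemma le_limn_einf {R : realType} (u v : (\bar R)^nat) :
  (\forall n \near \oo, u n <= v n)%E -> (limn_einf u <= limn_einf v)%E.
Proof.
move=> [N _ uv]; rewrite !limn_einf_lim; apply: lee_lim; [exact: is_cvg_einfs..|].
exists N => // n /= Nn; apply: le_ereal_inf_tmp => _ [m /= nm <-].
apply: le_trans (uv m (leq_trans Nn nm)).
by apply: ereal_inf_lbound; exists m.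
Qed.

Lemma limn_einf_cst {R : realType} (c : \bar R) : limn_einf (fun=> c) = c.
Proof.
have cc : (fun _ : nat => c) @ \oo --> c by exact: cvg_cst.
by rewrite (cvg_limn_einf_sup cc).1.
Qed.

Lemma integral_in_indic {R : realType} d (T : measurableType d)
    (m : {measure set T -> \bar R}) (B : set T) (f : T -> R) :
  (\int[m]_(s in B) (f s)%:E = \int[m]_s (f s * \1_B s)%:E)%E.
Proof.
rewrite integral_mkcond; apply: eq_integral => s _.
by rewrite patchE indicE; case: ifPn => sB; rewrite ?mulr1 ?mulr0.
Qed.

Section LocalAverages.
Context {R : realType} {dO dS : measure_display}
  {Om : measurableType dO} {S : measurableType dS}.
Variables (P : probability Om R) (mu : {sigma_finite_measure set S -> \bar R}).
Implicit Types (Y D : Om -> S -> R) (p q : R).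
Local Open Scope ereal_scope.

Lemma measurable_mask Y (B : set S) : measurable B ->
  measurable_fun setT (fun z => Y z.1 z.2) ->
  measurable_fun setT (fun z : Om * S => Y z.1 z.2 * \1_B z.2)%R.
Proof.
move=> mB mY; apply: measurable_funM => //.
by apply: (@measurableT_comp _ _ _ _ _ _ (\1_B : S -> R)) => //.

Qed.

(** Tonelli gives measurability of the integrals of the positive and negative parts separately,
    hence of their difference, even at outcomes where Y is not integrable on B. *)
Lemma measurable_pairing Y (B : set S) : measurable B ->
  measurable_fun setT (fun z => Y z.1 z.2) ->
  measurable_fun setT (pairing mu Y B).
Proof.
move=> mB mY; rewrite /pairing.
apply: (measurableT_comp (fine_measurable measurableT)).
have mYB := measurable_mask mB mY.
pose f z := (Y z.1 z.2 * \1_B z.2)%:E.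
have mf : measurable_fun setT f by exact/measurable_EFinP.
have -> : (fun w => \int[mu]_(s in B) (Y w s)%:E) =
    (fun w => fubini_F mu f^\+ w - fubini_F mu f^\- w).
  apply/funext => w; rewrite integral_in_indic -[fun s => _]/(f \o pair w) integralE.
  by rewrite funepos_comp funeneg_comp.
apply: (@emeasurable_funB _ _ _ _ (fubini_F mu f^\+) (fubini_F mu f^\-)).
  by apply: measurable_fun_fubini_tonelli_F => //; exact: measurable_funepos.
by apply: measurable_fun_fubini_tonelli_F => //; exact: measurable_funeneg.
Qed.

Lemma integral_powR_mask d (T : measurableType d) (m : {measure set T -> \bar R})
    (B : set T) (f : T -> R) p : (0 < p)%R ->
  \int[m]_(s in B) (`|f s| `^ p)%:E = \int[m]_s (`|f s * \1_B s| `^ p)%:E.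
Proof.
move=> p0; rewrite integral_in_indic; apply: eq_integral => s _.
rewrite indicE; case: (_ \in _); rewrite ?mulr1// !mulr0 normr0 powR0//.
by rewrite gt_eqF.
Qed.

Lemma moment_mask_le D (B : set S) q p : (1 <= p)%R -> (p <= q)%R ->
  measurable_fun setT (fun z => D z.1 z.2) -> measurable B ->
  \int[P]_w ((\int[mu]_(s in B) (`|D w s| `^ p)%:E) `^ (q / p)) <=
  (\int[mu]_(s in B) ((\int[P]_w (`|D w s| `^ q)%:E) `^ (p / q))) `^ (q / p).
Proof.
move=> p1 pq mD mB; have p0 : (0 < p)%R by lra.
have q0 : (0 < q)%R by lra.
have := @normLqLp_le_normLpLq _ _ _ _ _ P mu q p (fun w s => D w s * \1_B s)%R
  p1 pq (measurable_mask mB mD).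
rewrite normLqLpE normLpLqE => /(le_poweR (ltW q0)) => /(_ (poweR_ge0 _ _)).
rewrite -!poweRrM mulVf ?gt_eqF// (mulrC p^-1%R) poweRe1; last first.
  by apply: integral_ge0 => w _; exact: poweR_ge0.
under eq_integral do rewrite -integral_powR_mask//.
move=> /le_trans; apply; apply: le_poweR.
- by rewrite divr_ge0// ltW.
- by apply: integral_ge0 => s _; exact: poweR_ge0.
rewrite le_eqVlt; apply/orP; left; apply/eqP.
rewrite [RHS]integral_mkcond; apply: eq_integral => s _.
rewrite patchE; case: ifPn => sB.
  by under eq_integral do rewrite indicE sB mulr1.
under eq_integral do rewrite indicE (negbTE sB) mulr0 normr0 powR0 ?gt_eqF//.
by rewrite integral0 poweR0r// mulf_neq0 ?invr_neq0 ?gt_eqF.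
Qed.

(** Jensen on B for each outcome, then Minkowski's integral inequality on B. The factor mu B is
    carried inside the power p/q as mu(B)^(q/p); the left side is the integral over B of the
    corresponding constant, ready to be summed over blocks. *)
Lemma moment_average_le D (B : set S) q p : (1 <= p)%R -> (p <= q)%R ->
  measurable_fun setT (fun z => D z.1 z.2) -> measurable B ->
  0 < mu B -> mu B < +oo ->
  (\int[P]_w (`|(fine (mu B))^-1 * pairing mu D B w| `^ q)%:E) `^ (p / q) * mu B <=
  \int[mu]_(s in B) ((\int[P]_w (`|D w s| `^ q)%:E) `^ (p / q)).
Proof.
move=> p1 pq mD mB B0 By; have p0 : (0 < p)%R by lra.
have q0 : (0 < q)%R by lra.
have mV : measurable_fun setT (fun w => (fine (mu B))^-1 * pairing mu D B w)%R.
  by apply: measurable_funM => //; exact: measurable_pairing.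
set v := ((fine (mu B))^-1)%R in mV *.
have mDp : measurable_fun setT (fun w => \int[mu]_(s in B) (`|D w s| `^ p)%:E).
  under eq_fun do rewrite integral_powR_mask//.
  apply: (measurable_fun_fubini_tonelli_F
    (fun z : Om * S => (`|D z.1 z.2 * \1_B z.2| `^ p)%:E)).
    by apply: measurable_normr_powR; exact: measurable_mask.
  by move=> z; rewrite lee_fin powR_ge0.
have pq0 : (0 <= p / q)%R by rewrite divr_ge0// ltW.
have qp0 : (0 <= q / p)%R by rewrite divr_ge0// ltW.
have pqqp : (p / q * (q / p) = 1)%R by field; rewrite !gt_eqF.
have IB0 : 0 <= \int[mu]_(s in B) ((\int[P]_w (`|D w s| `^ q)%:E) `^ (p / q)).
  by apply: integral_ge0 => s _; exact: poweR_ge0.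
rewrite -[leRHS]poweRe1// -pqqp (mulrC (p / q)%R) [leRHS]poweRrM.
apply: le_trans (le_poweR pq0 _ (moment_mask_le p1 pq mD mB)); last first.
  by apply: integral_ge0 => w _; exact: poweR_ge0.
have -> : mu B = (mu B `^ (q / p)) `^ (p / q).
  by rewrite -poweRrM (mulrC (q / p)%R) pqqp poweRe1// ltW.
rewrite -poweRM ?integral_normr_powR_ge0 ?poweR_ge0//; apply: le_poweR => //.
  by rewrite mule_ge0 ?integral_normr_powR_ge0 ?poweR_ge0.
rewrite -ge0_integralZr//=; [|exact: measurable_normr_powR|exact: poweR_ge0].
apply: ge0_le_integral => //.
- by move=> w _; rewrite mule_ge0 ?poweR_ge0// lee_fin powR_ge0.
- apply: emeasurable_funM => //; exact: measurable_normr_powR.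
- apply: (@measurableT_comp _ _ _ _ _ _ (fun x => poweR x (q / p))) => //.
  exact: measurable_poweR.
move=> w _; have J := jensen_average p1 (measurable_joint1 w mD) mB B0 By.
have -> : (`|(v * pairing mu D B w)%R| `^ q)%:E = ((`|(v * pairing mu D B w)%R| `^ p)%:E) `^ (q / p).
  by rewrite poweR_EFin -powRrM mulrCA mulfV ?mulr1 ?gt_eqF.
rewrite -poweRM ?lee_fin ?powR_ge0 ?(ltW B0)//.
by apply: le_poweR J => //; rewrite mule_ge0 ?lee_fin ?powR_ge0// ltW.
Qed.

(** Fubini moves the expectation inside the integral over B. Joint integrability of D on Omega x B
    comes from |t| <= 1 + |t|^p on B, then x <= 1 + x^(q/p) for the resulting integral, then
    [moment_mask_le]. Because of [fine], the pairing equals the inner integral only for almost every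
    w. *)
Lemma pairing_centered D (B : set S) q p : (1 <= p)%R -> (p <= q)%R ->
  measurable_fun setT (fun z => D z.1 z.2) -> measurable B -> mu B < +oo ->
  \int[mu]_(s in B) ((\int[P]_w (`|D w s| `^ q)%:E) `^ (p / q)) < +oo ->
  {ae mu, forall s, \int[P]_w (D w s)%:E = 0} ->
  P.-integrable setT (EFin \o pairing mu D B) /\
  \int[P]_w (pairing mu D B w)%:E = 0.
Proof.
move=> p1 pq mD mB By Ih mean0; have p0 : (0 < p)%R by lra.
have q0 : (0 < q)%R by lra.
have qp1 : (1 <= q / p)%R by rewrite ler_pdivlMr// mul1r.
have qp0 : (0 <= q / p)%R by lra.
pose f (z : Om * S) := (D z.1 z.2 * \1_B z.2)%:E.
have mf : measurable_fun setT f by apply/measurable_EFinP; exact: measurable_mask.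
have mDp : measurable_fun setT (fun w => \int[mu]_(s in B) (`|D w s| `^ p)%:E).
  under eq_fun do rewrite integral_powR_mask//.
  apply: (measurable_fun_fubini_tonelli_F
    (fun z : Om * S => (`|D z.1 z.2 * \1_B z.2| `^ p)%:E)).
    by apply: measurable_normr_powR; exact: measurable_mask.
  by move=> z; rewrite lee_fin powR_ge0.
have mDpr : measurable_fun setT
    (fun w => (\int[mu]_(s in B) (`|D w s| `^ p)%:E) `^ (q / p)).
  apply: (@measurableT_comp _ _ _ _ _ _ (fun x => poweR x (q / p))) => //.
  exact: measurable_poweR.
have If : (P \x mu).-integrable setT f.
  apply/integrable12ltyP => //.
  apply: (@le_lt_trans _ _ (\int[P]_w ((mu B + 1) +
    (\int[mu]_(s in B) (`|D w s| `^ p)%:E) `^ (q / p)))).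
    apply: ge0_le_integral => //.
    - by move=> w _; apply: integral_ge0.
    - apply: (measurable_fun_fubini_tonelli_F (abse \o f)).
        exact: measurableT_comp.
      by move=> z; exact: abse_ge0.
    - exact: emeasurable_funD.
    move=> w _.
    have mDw := measurable_joint1 w mD.
    apply: (@le_trans _ _ (mu B + \int[mu]_(s in B) (`|D w s| `^ p)%:E)).
      have -> : \int[mu]_s `|f (w, s)| = \int[mu]_(s in B) `|D w s|%:E.
        rewrite [RHS]integral_in_indic; apply: eq_integral => s _.
        by rewrite /f/= normrM [X in (_ * X)%R]ger0_norm.
      have -> : mu B = \int[mu]_(s in B) 1%:E by rewrite integral_cst// mul1e.
      rewrite -ge0_integralD//=; last first.
        by apply: measurable_funS (measurable_normr_powR p mDw).
      apply: ge0_le_integral => //.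
      - apply: measurable_funS (_ : measurable_fun setT _) => //.
        by apply/measurable_EFinP; exact: measurableT_comp.
      - apply: emeasurable_funD => //.
        by apply: measurable_funS (measurable_normr_powR p mDw).
      move=> s _; rewrite -EFinD lee_fin.
      exact: le_add1_powR.
    rewrite -addeA leeD2l//.
    set x := \int[mu]_(s in B) _; have x0 : 0 <= x by exact: integral_normr_powR_ge0.
    case: x x0 => [x|_|//]; last first.
      by rewrite poweRyr ?gt_eqF// ?divr_gt0// addey.
    rewrite lee_fin => x0; rewrite poweR_EFin -EFinD lee_fin.
    exact: le_add1_powR.
  rewrite ge0_integralD//; last 2 first.
  - by move=> w _; rewrite adde_ge0.
  - by move=> w _; exact: poweR_ge0.
  rewrite integral_cst_probability; apply: lte_add_pinfty.
    by apply: lte_add_pinfty => //; exact: ltry.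
  apply: le_lt_trans (moment_mask_le p1 pq mD mB) _.
  exact: poweR_lty.
have IF := integrable_fubini_F If.
have ae1 := ae_integrable1 If.
have aeE : {ae P, forall w, fubini_F mu f w = (pairing mu D B w)%:E}.
  apply: filterS ae1 => w Iw; rewrite /pairing integral_in_indic fineK//.
  by apply: integrable_fin_num.
have mP : measurable_fun setT (EFin \o pairing mu D B).
  by apply/measurable_EFinP; exact: measurable_pairing.
split.
  apply/integrableP; split => //.
  move/integrableP : IF => [mF]; apply: le_lt_trans.
  apply: ae_ge0_le_integral => //; [exact: measurableT_comp|exact: measurableT_comp|].
  by apply: filterS aeE => w -> _.
transitivity (\int[P]_w fubini_F mu f w).
  apply: ae_eq_integral => //; first exact: measurable_int IF.
  by apply: filterS aeE => w -> _.
rewrite /fubini_F (Fubini If).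
transitivity (\int[mu]_s cst 0 s); last by rewrite integral0.
apply: ae_eq_integral => //.
  exact: (measurable_fubini_G If).
apply: filterS mean0 => s D0 _; rewrite /f/= indicE; case: (_ \in _).
  by under eq_integral do rewrite mulr1.
by under eq_integral do rewrite mulr0; rewrite integral0.
Qed.

End LocalAverages.

(** * Transfer of integrals and independence between real variables *)

Section LawTransfer.
Context {R : realType} {d : measure_display} {Om : measurableType d}.
Variable P : probability Om R.

Definition same_distribution (X X' : Om -> R) :=
  forall U : set R, measurable U -> P (X @^-1` U) = P (X' @^-1` U).

Lemma ge0_integral_same_distribution (X X' : {mfun Om >-> R}) (f : R -> \bar R) :
  same_distribution X X' -> measurable_fun setT f -> (forall x, 0 <= f x)%E ->
  (\int[P]_w f (X w) = \int[P]_w f (X' w))%E.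
Proof.
move=> XX' mf f0; rewrite -!ge0_integral_distribution//.
by apply: eq_measure_integral => A mA _; exact: XX'.
Qed.

Lemma integral_same_distribution (X X' : {mfun Om >-> R}) (f : R -> \bar R) :
  same_distribution X X' -> measurable_fun setT f ->
  P.-integrable setT (f \o X) -> P.-integrable setT (f \o X') ->
  (\int[P]_w f (X w) = \int[P]_w f (X' w))%E.
Proof.
move=> XX' mf IX IX'.
rewrite -(integral_distribution mf IX) -(integral_distribution mf IX').
by apply: eq_measure_integral => A mA _; exact: XX'.
Qed.

Lemma mutually_indep_comp (Z : nat -> Om -> R) (g : R -> R) :
  measurable_fun setT g -> mutually_indep P Z ->
  mutually_indep P (fun j => g \o Z j).
Proof.
move=> mg iZ J U uJ mU; have := iZ J (fun j => g @^-1` (U j)) uJ; apply.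
by move=> j /mU mUj; rewrite -[X in measurable X]setTI; exact: mg.
Qed.

End LawTransfer.

Section BlockMoments.
Context {R : realType} {dO dS : measure_display}
  {Om : measurableType dO} {S : measurableType dS}.
Variables (P : probability Om R) (mu : {sigma_finite_measure set S -> \bar R}).
Implicit Types (B : set S) (p q : R).

Lemma same_law_pairing (Y Y' : Om -> S -> R) B :
  same_law P mu Y Y' -> measurable B -> (mu B < +oo)%E ->
  same_distribution P (pairing mu Y B) (pairing mu Y' B).
Proof.
move=> YY' mB By U mU.
have := YY' 1%N (fun=> B) (fun=> U) (fun _ _ => conj mB (conj By mU)).
suff E (Z : Om -> S -> R) : cyl mu Z 1 (fun=> B) (fun=> U) = pairing mu Z B @^-1` U.
  by rewrite !E.
apply/seteqP; split => w /=; first by move=> /(_ 0%N isT).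
by move=> h i _.
Qed.

Lemma indep_pairing (Y : nat -> Om -> S -> R) B :
  indep_family P mu Y -> measurable B -> (mu B < +oo)%E ->
  mutually_indep P (fun j => pairing mu (Y j) B).
Proof.
move=> iY mB By J U uJ mU.
have := iY J uJ (fun=> 1%N) (fun _ _ => B) (fun j _ => U j)
  (fun j jJ _ _ => conj mB (conj By (mU j jJ))).
have E j : cyl mu (Y j) 1 (fun=> B) (fun=> U j) = pairing mu (Y j) B @^-1` U j.
  apply/seteqP; split => w /=; first by move=> /(_ 0%N isT).
  by move=> h i _.
under eq_bigr do rewrite E.
move=> <-; congr (P _); apply/seteqP; split => w /= h j jJ.
  by rewrite E; exact: h.
by have := h j jJ; rewrite E.
Qed.

(** The constant of [moment_sum_le], chosen once, so that it is visibly the same for all blocks,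
    levels and sample sizes. *)
Definition moment_const q (q2 : 2 <= q) : R := projT1 (cid2 (moment_sum_le P q2)).

Lemma moment_const_gt0 q (q2 : 2 <= q) : 0 < moment_const q2.
Proof. by rewrite /moment_const; case: cid2. Qed.

Lemma moment_constP q (q2 : 2 <= q) (Z : nat -> {mfun Om >-> R}) (b : R) :
  mutually_indep P Z ->
  (forall j, P.-integrable setT (EFin \o Z j)) ->
  (forall j, \int[P]_w (Z j w)%:E = 0)%E ->
  (forall j, \int[P]_w (`|Z j w| `^ q)%:E = b%:E)%E ->
  forall m, (0 < m)%N ->
  (\int[P]_w (`|(\sum_(1 <= j < m.+1) Z j w)%R| `^ q)%:E <=
    (moment_const q2 * m%:R `^ (q / 2) * b)%:E)%E.
Proof. by rewrite /moment_const; case: cid2 => D D0 H; exact: H. Qed.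

(** The scalars v (<Y_j, B> - c), with v = 1/mu(B), are independent and have the law of the average
    of xi - m over B; this transports the zero mean and the q-th moment to the copies. Then M^(-q)
    M^(q/2) = M^(-q/2), and [moment_average_le] bounds the single moment. The number c plays the
    role of the integral of m over B; the sign is that of m minus the sample mean. *)
Lemma block_moment q p (q2 : 2 <= q) (xi : Om -> S -> R) (m : S -> R)
    (Y : nat -> Om -> S -> R) B (c : R) (M : nat) :
  1 <= p -> p <= q ->
  measurable_fun setT (fun z : Om * S => xi z.1 z.2) ->
  measurable_fun setT m ->
  (forall j, measurable_fun setT (fun z : Om * S => Y j z.1 z.2)) ->
  (forall j, same_law P mu (Y j) xi) -> indep_family P mu Y ->
  measurable B -> (0 < mu B)%E -> (mu B < +oo)%E ->
  (\int[mu]_(s in B) ((\int[P]_w (`|xi w s - m s| `^ q)%:E) `^ (p / q)) < +oo)%E ->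
  {ae mu, forall s, (\int[P]_w (xi w s - m s)%:E = 0)%E} ->
  {ae P, forall w, pairing mu xi B w - c = pairing mu (fun w s => xi w s - m s) B w} ->
  (0 < M)%N ->
  ((\int[P]_w (`|- (M%:R^-1 * \sum_(1 <= j < M.+1)
       ((fine (mu B))^-1 * (pairing mu (Y j) B w - c)))%R| `^ q)%:E) `^ (p / q) * mu B <=
   ((moment_const q2 * M%:R `^ (- (q / 2))) `^ (p / q))%:E *
   \int[mu]_(s in B) ((\int[P]_w (`|xi w s - m s| `^ q)%:E) `^ (p / q)))%E.
Proof.
move=> p1 pq mxi mm mY lawY iY mB B0 By Ih mean0 aeD M0.
pose D w s := xi w s - m s.
have mD : measurable_fun setT (fun z : Om * S => D z.1 z.2).
  by apply: measurable_funB => //; exact: (measurableT_comp mm).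
have p0 : 0 < p by lra.
have q0 : 0 < q by lra.
have q1 : 1 <= q by lra.
pose v := (fine (mu B))^-1; rewrite -/v.
have v0 : 0 < v by rewrite invr_gt0 fine_gt0// B0.
pose V w := v * pairing mu D B w.
have mpD := measurable_pairing mu mB mD.
have mV : measurable_fun setT V by exact: measurable_funM.
have [IpD EpD] := pairing_centered p1 pq mD mB By Ih mean0.
have IV : P.-integrable setT (EFin \o V) by exact: (integrableZl measurableT v IpD).
have EV : (\int[P]_w (V w)%:E = 0)%E.
  transitivity (\int[P]_w (v%:E * (pairing mu D B w)%:E))%E; first by [].
  by rewrite (integralZl measurableT IpD) EpD mule0.
have bV := moment_average_le P p1 pq mD mB B0 By.
rewrite -/v in bV.
have bfin : (\int[P]_w (`|V w| `^ q)%:E < +oo)%E.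
  have h := le_lt_trans bV Ih; rewrite ltey; apply/eqP => e; move: h.
  by rewrite e poweRyr ?gt_eqF ?divr_gt0// gt0_mulye.
pose b := fine (\int[P]_w (`|V w| `^ q)%:E)%E.
have b0 : 0 <= b by rewrite fine_ge0// integral_normr_powR_ge0.
have bE : (\int[P]_w (`|V w| `^ q)%:E = b%:E)%E.
  by rewrite fineK// ge0_fin_numE// integral_normr_powR_ge0.
pose g x := v * (x - c).
have mg : measurable_fun setT g.
  by apply: measurable_funM => //; exact: measurable_funB.
have mp j := measurable_pairing mu mB (mY j).
have mZ j : measurable_fun setT (g \o pairing mu (Y j) B) by exact: measurableT_comp.
pose Z j : {mfun Om >-> R} := mfun_Sub (mem_set (mZ j)).
have iZ : mutually_indep P Z by exact: mutually_indep_comp (indep_pairing iY mB By).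
have mpx := measurable_pairing mu mB mxi.
have aeg : {ae P, forall w, g (pairing mu xi B w) = V w}.
  by apply: filterS aeD => w e; rewrite /g e.
pose mX j : {mfun Om >-> R} := mfun_Sub (mem_set (mp j)).
pose mX0 : {mfun Om >-> R} := mfun_Sub (mem_set mpx).
have dX j : same_distribution P (mX j) mX0 by exact: same_law_pairing.
have EZq j : (\int[P]_w (`|Z j w| `^ q)%:E = b%:E)%E.
  transitivity (\int[P]_w (`|g (mX j w)| `^ q)%:E)%E; first by [].
  rewrite (@ge0_integral_same_distribution _ _ _ P (mX j) mX0 (fun x => (`|g x| `^ q)%:E))//; last first.
    exact: measurable_normr_powR.
  rewrite -bE; apply: ge0_ae_eq_integral => //.
  - by apply: measurable_normr_powR; exact: (measurableT_comp mg mpx).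
  - exact: measurable_normr_powR.
  by apply: filterS aeg => w /= -> _.
have IZ j : P.-integrable setT (EFin \o Z j).
  apply: (integrable_powR q1) => //.
  - by apply: le_lt_trans (probability_le1 P measurableT) _; rewrite ltry.
  - by rewrite EZq ltry.
have mgE : measurable_fun setT (EFin \o g) by exact/measurable_EFinP.
have IX0 : P.-integrable setT ((EFin \o g) \o mX0).
  apply/integrableP; split; first exact: (measurableT_comp mgE mpx).
  move/integrableP : IV => [mVE]; apply: le_lt_trans.
  apply: ae_ge0_le_integral => //.
  - by apply: measurableT_comp => //; exact: (measurableT_comp mgE mpx).
  - exact: measurableT_comp.
  by apply: filterS aeg => w /= -> _.
have EZ j : (\int[P]_w (Z j w)%:E = 0)%E.
  transitivity (\int[P]_w (EFin \o g) (mX j w))%E; first by [].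
  rewrite (integral_same_distribution (dX j) mgE (IZ j) IX0) -EV.
  apply: ae_eq_integral => //; [exact: measurable_int IX0|exact: measurable_int IV|].
  by apply: filterS aeg => w /= -> _.
have H := moment_constP q2 iZ IZ EZ EZq M0.
have Mp : 0 < M%:R :> R by rewrite ltr0n.
set k := moment_const q2 in H *.
have k0 : 0 < k by exact: moment_const_gt0.
have mSZ : measurable_fun setT (fun w => \sum_(1 <= j < M.+1) Z j w).
  by apply: measurable_sum => j.
have HW : (\int[P]_w (`|- (M%:R^-1 * \sum_(1 <= j < M.+1)
      (v * (pairing mu (Y j) B w - c)))%R| `^ q)%:E <=
    (k * M%:R `^ (- (q / 2)))%:E * b%:E)%E.
  have -> : (\int[P]_w (`|- (M%:R^-1 * \sum_(1 <= j < M.+1)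
      (v * (pairing mu (Y j) B w - c)))%R| `^ q)%:E =
    (M%:R `^ (- q))%:E * \int[P]_w (`|(\sum_(1 <= j < M.+1) Z j w)%R| `^ q)%:E)%E.
    rewrite -ge0_integralZl//; last exact: measurable_normr_powR.
    apply: eq_integral => w _; rewrite -EFinM; congr EFin.
    rewrite normrN normrM powRM//; congr (_ * _).
    by rewrite ger0_norm ?invr_ge0 ?(ltW Mp)// -powR_inv1 ?(ltW Mp)// -powRrM mulN1r.
  apply: (le_trans (lee_wpmul2l _ H)); first by rewrite lee_fin powR_ge0.
  rewrite -!EFinM lee_fin mulrA (mulrCA (M%:R `^ _)) -powRD; last first.
    by rewrite (gt_eqF Mp) implybT.
  by have -> : - q + q / 2 = - (q / 2) by field.
have pq0 : 0 <= p / q by rewrite divr_ge0// ltW.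
apply: (@le_trans _ _ (((k * M%:R `^ (- (q / 2)))%:E * b%:E) `^ (p / q) * mu B)%E).
  apply: lee_wpmul2r => //.
  by apply: le_poweR => //; exact: integral_normr_powR_ge0.
rewrite poweRM ?lee_fin ?mulr_ge0 ?powR_ge0 ?(ltW k0)// -muleA.
apply: lee_wpmul2l; first exact: poweR_ge0.
by rewrite -bE.
Qed.

End BlockMoments.

(** * Error of one level *)


Lemma integral_affine_sum {R : realType} d (T : measurableType d)
    (m : {measure set T -> \bar R}) (B : set T) (f : T -> R) (a : R)
    (r : seq nat) (y : nat -> T -> R) : measurable B ->
  m.-integrable B (EFin \o f) -> (forall j, m.-integrable B (EFin \o y j)) ->
  (fine (\int[m]_(s in B) (f s - a * \sum_(j <- r) y j s)%:E) =
   fine (\int[m]_(s in B) (f s)%:E) -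
   a * \sum_(j <- r) fine (\int[m]_(s in B) (y j s)%:E))%R.
Proof.
move=> mB If Iy.
have Is : m.-integrable B (EFin \o (fun s => \sum_(j <- r) y j s)).
  have := integrable_sum mB r (P := xpredT) (h := fun j => EFin \o y j).
  move=> /(_ m (fun j _ => Iy j)); apply: eq_integrable => // s _ /=.
  by rewrite sumEFin.
have Ias : m.-integrable B (EFin \o (fun s => a * \sum_(j <- r) y j s)).
  exact: (integrableZl mB a Is).
have Es : (\int[m]_(s in B) (\sum_(j <- r) y j s)%:E =
   (\sum_(j <- r) fine (\int[m]_(s in B) (y j s)%:E))%:E)%E.
  under eq_integral do rewrite -sumEFin.
  rewrite (integral_sum mB (fun j => Iy j)) -sumEFin; apply: eq_bigr => j _.
  by rewrite fineK//; apply: integrable_fin_num => //; exact: Iy.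
have Eas : (\int[m]_(s in B) (a * \sum_(j <- r) y j s)%:E =
   (a * \sum_(j <- r) fine (\int[m]_(s in B) (y j s)%:E))%:E)%E.
  by rewrite EFinM -Es -(integralZl mB Is).
transitivity (fine (\int[m]_(s in B) (f s)%:E -
    \int[m]_(s in B) (a * \sum_(j <- r) y j s)%:E)%E).
  by rewrite -(integralB_EFin mB If Ias).
rewrite Eas fineB//; exact: integrable_fin_num.
Qed.

Section Fatou.
Context {R : realType} {dO dS : measure_display}
  {Om : measurableType dO} {S : measurableType dS}.
Variables (P : probability Om R) (mu : {sigma_finite_measure set S -> \bar R}).
Implicit Types (B : set S) (p q : R).

Lemma normLpSB p (f g : S -> R) :
  normLpS mu p (fun s => f s - g s) = normLpS mu p (fun s => g s - f s).
Proof.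
rewrite !normLpSE; congr (poweR _ _); apply: eq_integral => s _.
by rewrite (distrC (f s)).
Qed.

Lemma normLpS_triangle p (f g : S -> R) : 1 <= p ->
  measurable_fun setT f -> measurable_fun setT g ->
  (normLpS mu p f <= normLpS mu p g + normLpS mu p (fun s => g s - f s)%R)%E.
Proof.
move=> p1 mf mg; rewrite normLpSB.
have := minkowski_EFin mu mg (measurable_funB mf mg) p1.
by rewrite /normLpS; under [X in (Lnorm _ _ X <= _)%E]eq_fun do rewrite /= addrC subrK.
Qed.

(** The tangent to t^q at e = ||f|| gives ||g_n||^q >= e^q - q e^(q-1) ||g_n - f||, which is trivial
    when ||g_n|| is infinite, and the right side tends to e^q. *)
Lemma normLpS_le_liminf p q (f : S -> R) (g : nat -> S -> R) :
  1 <= p -> 1 <= q -> measurable_fun setT f ->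
  (forall n, measurable_fun setT (g n)) ->
  (\int[mu]_s (`|f s| `^ p)%:E < +oo)%E ->
  (fun n => \int[mu]_s (`|g n s - f s| `^ p)%:E)%E @ \oo --> 0%E ->
  (normLpS mu p f `^ q <= limn_einf (fun n => normLpS mu p (g n) `^ q))%E.
Proof.
pose rho n := (\int[mu]_s (`|g n s - f s| `^ p)%:E)%E.
move=> p1 q1 mf mg If; rewrite -/rho => /fine_cvgP[rfin /cvgrPdist_le r0].
have p0 : 0 < p by lra.
have q0 : 0 < q by lra.
have rho0 n : (0 <= rho n)%E by exact: integral_normr_powR_ge0.
pose r n := fine (rho n) `^ p^-1.
have r_cvg : r @ \oo --> 0.
  apply/cvgrPdist_le => e e0; apply: filterS (r0 _ (powR_gt0 p e0)) => n /=.
  rewrite !sub0r !normrN !ger0_norm ?powR_ge0 ?fine_ge0// => h.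
  have pN0 : p != 0 by rewrite gt_eqF.
  rewrite /r -[leRHS](powRr1 (ltW e0)) -(mulfV pN0) powRrM.
  by apply: ge0_ler_powR; rewrite ?invr_ge0 ?nnegrE ?powR_ge0 ?fine_ge0 ?(ltW p0).
have Nf : (normLpS mu p f < +oo)%E by rewrite normLpS_lty.
pose e := fine (normLpS mu p f).
have eE : normLpS mu p f = e%:E by rewrite fineK// ge0_fin_numE// normLpS_ge0.
have e0 : 0 <= e by rewrite fine_ge0// normLpS_ge0.
pose v n : \bar R := (e `^ q - q * e `^ (q - 1) * r n)%:E.
have v_cvg : v @ \oo --> (e `^ q)%:E.
  apply: cvg_EFin; first exact: nearW.
  rewrite -[X in _ --> X](subr0 (e `^ q)); apply: cvgB; first exact: cvg_cst.
  by rewrite -[X in _ --> X](mulr0 (q * e `^ (q - 1))); apply: cvgM => //; exact: cvg_cst.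
rewrite eE poweR_EFin -[leLHS](cvg_limn_einf_sup v_cvg).1.
apply: le_limn_einf; apply: filterS rfin => n rn.
have [->|gfin] := eqVneq (normLpS mu p (g n)) +oo%E.
  by rewrite poweRyr ?gt_eqF// leey.
pose a := fine (normLpS mu p (g n)).
have aE : normLpS mu p (g n) = a%:E.
  by rewrite fineK// ge0_fin_numE ?normLpS_ge0// ltey.
have a0 : 0 <= a by rewrite fine_ge0// normLpS_ge0.
have rE : normLpS mu p (fun s => g n s - f s) = (r n)%:E.
  by rewrite normLpSE -/(rho n) -{1}(fineK rn).
have := normLpS_triangle p1 mf (mg n).
rewrite eE aE rE -EFinD lee_fin => ear.
rewrite /v poweR_EFin lee_fin.
apply: le_trans (powR_tangent q1 a0 e0).
rewrite lerD2l -mulrN; apply: ler_wpM2l; first by rewrite mulr_ge0 ?powR_ge0// ltW.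
by lra.
Qed.

End Fatou.

Section LevelError.
Context {R : realType} {dO dS : measure_display}
  {Om : measurableType dO} {S : measurableType dS}.
Variables (P : probability Om R) (mu : {sigma_finite_measure set S -> \bar R}).
Variables (p q : R).
Hypotheses (q2 : 2 <= q) (p1 : 1 <= p) (pq : p <= q).
Variables (xi : Om -> S -> R) (m : S -> R) (Y : nat -> Om -> S -> R).
Hypothesis happrox : approx_by_averaging mu.
Hypothesis mm : measurable_fun setT m.
Hypothesis xiL : LpS_rv P mu p xi.
Hypothesis Dfin : (normLpLq P mu p q (fun w s => xi w s - m s)%R < +oo)%E.
Hypothesis mean0 : {ae mu, forall s, (\int[P]_w (xi w s - m s)%:E = 0)%E}.
Hypothesis YL : forall j, LpS_rv P mu p (Y j).
Hypothesis lawY : forall j, same_law P mu (Y j) xi.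
Hypothesis iY : indep_family P mu Y.

Let p0 : 0 < p. Proof. exact: lt_le_trans ltr01 p1. Qed.
Let q0 : 0 < q. Proof. exact: lt_le_trans p0 pq. Qed.
Let q1 : 1 <= q. Proof. exact: le_trans p1 pq. Qed.
Let mxi : measurable_fun setT (fun z : Om * S => xi z.1 z.2). Proof. exact: xiL.1. Qed.
Let mY j : measurable_fun setT (fun z : Om * S => Y j z.1 z.2). Proof. exact: (YL j).1. Qed.
Let D w s := xi w s - m s.
Let mD : measurable_fun setT (fun z : Om * S => D z.1 z.2).
Proof. by apply: measurable_funB => //; exact: (measurableT_comp mm). Qed.

(** The p-th power of the L^q(Omega) norm at s; its integral over S is the p-th power of the mixed
    norm of xi - m. *)
Let h (s : S) : \bar R := ((\int[P]_w (`|D w s| `^ q)%:E) `^ (p / q))%E.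

Let h0 s : (0 <= h s)%E. Proof. exact: poweR_ge0. Qed.

Let mh : measurable_fun setT h.
Proof.
apply: (@measurableT_comp _ _ _ _ _ _ (fun x => poweR x (p / q))).
  exact: measurable_poweR.
apply: (measurable_fun_fubini_tonelli_G (fun z : Om * S => (`|D z.1 z.2| `^ q)%:E)).
  exact: measurable_normr_powR.
by move=> z; rewrite lee_fin powR_ge0.
Qed.

Let Ih : (\int[mu]_s h s < +oo)%E.
Proof.
move: Dfin; rewrite normLpLqE; apply: lty_poweRy.
by rewrite invr_neq0// gt_eqF.
Qed.

Let aeD : {ae P, forall w, (normLpS mu p (D w) < +oo)%E}.
Proof.
apply: (@normLqLp_lty _ _ _ _ _ P mu q p D q0) => //.
exact: le_lt_trans (normLqLp_le_normLpLq P mu p1 pq mD) Dfin.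
Qed.

(** Almost every outcome w has both xi(w) and xi(w) - m in L^p(S), and P has positive mass, so one
    such w exists; m is the difference. *)
Lemma level_mean_Lp : (\int[mu]_s (`|m s| `^ p)%:E < +oo)%E.
Proof.
have PT : (0 < P setT)%E by rewrite (@probability_setT _ _ _ P).
have FP := ae_properfilter_algebraOfSetsType PT.
have [w [Dw xiw]] := filter_ex (filterI aeD xiL.2).
rewrite -normLpS_lty//.
have mxw := measurable_joint1 w mxi.
apply: le_lt_trans (normLpS_triangle mu p1 mm mxw) _.
exact: lte_add_pinfty.
Qed.

Let err M w s := m s - M%:R^-1 * \sum_(1 <= j < M.+1) Y j w s.

Let merr M : measurable_fun setT (fun z : Om * S => err M z.1 z.2).
Proof.
apply: measurable_funB; first exact: (measurableT_comp mm).
by apply: measurable_funM => //; apply: measurable_sum => j; exact: mY.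
Qed.

(** The average of [err M w] over B, written with pairings. It is measurable in w as it stands, and
    [average_err] identifies it with the average when all copies lie in L^p(S). *)
Let W M (B : set S) w := - (M%:R^-1 * \sum_(1 <= j < M.+1)
  ((fine (mu B))^-1 * (pairing mu (Y j) B w - fine (\int[mu]_(s in B) (m s)%:E)%E))).

Let mW M B : measurable B -> measurable_fun setT (W M B).
Proof.
move=> mB; apply: measurableT_comp => //; apply: measurable_funM => //.
apply: measurable_sum => j; apply: measurable_funM => //.
by apply: measurable_funB => //; exact: (measurable_pairing mu mB (mY j)).
Qed.

Let integrable_on (f : S -> R) B : measurable_fun setT f -> measurable B -> (mu B < +oo)%E ->
  (\int[mu]_s (`|f s| `^ p)%:E < +oo)%E -> mu.-integrable B (EFin \o f).
Proof.
move=> mf mB By If; apply: (integrable_powR p1 mf mB By).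
apply: le_lt_trans If; apply: ge0_subset_integral => //.
exact: measurable_normr_powR.
Qed.

Let average_err M B w : (0 < M)%N -> measurable B -> (mu B < +oo)%E ->
  (forall j, (normLpS mu p (Y j w) < +oo)%E) ->
  (fine (mu B))^-1 * fine (\int[mu]_(s in B) (err M w s)%:E)%E = W M B w.
Proof.
move=> M0 mB By Yw.
have Im := integrable_on mm mB By level_mean_Lp.
have IY j : mu.-integrable B (EFin \o Y j w).
  by apply: integrable_on => //; [exact: (measurable_joint1 w (mY j))|rewrite -normLpS_lty].
rewrite /err (integral_affine_sum _ _ mB Im IY) /W.
set c := fine (\int[mu]_(s in B) (m s)%:E)%E.
have M0' : M%:R != 0 :> R by rewrite pnatr_eq0 -lt0n.
rewrite -big_distrr/= sumrB [X in _ * (_ * (_ - X))]big_const_nat subSS subn0/= iter_addr addr0.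
rewrite -mulr_natr /pairing; move: ((fine (mu B))^-1) => v.
by field.
Qed.

Let moment_block M B : (0 < M)%N -> measurable B -> (0 < mu B)%E -> (mu B < +oo)%E ->
  ((\int[P]_w (`|W M B w| `^ q)%:E) `^ (p / q) * mu B <=
   ((moment_const P q2 * M%:R `^ (- (q / 2))) `^ (p / q))%:E * \int[mu]_(s in B) h s)%E.
Proof.
move=> M0 mB B0 By; apply: block_moment => //.
  apply: le_lt_trans Ih; apply: (@ge0_subset_integral _ _ _ mu B setT) => // s _.
  exact: h0.
have Im := integrable_on mm mB By level_mean_Lp.
apply: filterS xiL.2 => w xiw.
have Ixi : mu.-integrable B (EFin \o xi w).
  by apply: integrable_on => //; [exact: (measurable_joint1 w mxi)|rewrite -normLpS_lty].
have fxi : (\int[mu]_(s in B) (xi w s)%:E)%E \is a fin_num by exact: integrable_fin_num.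
have fm : (\int[mu]_(s in B) (m s)%:E)%E \is a fin_num by exact: integrable_fin_num.
by rewrite /pairing -fineB// -(integralB_EFin mB Ixi Im).
Qed.

Lemma level_estimate M : (0 < M)%N ->
  (normLqLp P mu q p (fun w s => m s - M%:R^-1 * \sum_(1 <= j < M.+1) Y j w s)%R <=
   (moment_const P q2 `^ q^-1 * M%:R `^ (- 2^-1))%:E *
   normLpLq P mu p q (fun w s => xi w s - m s)%R)%E.
Proof.
move=> M0; have [K [Bs [HB [dB H]]]] := happrox.
pose C n w k := W M (Bs n k) w.
pose T n w s := step (K n) (Bs n) (C n w) s.
have mBs n k : K n k -> measurable (Bs n k) by move=> /HB[].
have mT n : measurable_fun setT (fun z : Om * S => T n z.1 z.2).
  by apply: measurable_step (mBs n) (dB n) _ => k /mBs; exact: mW.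
set k0 := moment_const P q2.
have k0_gt0 : 0 < k0 by exact: moment_const_gt0.
have M_gt0 : 0 < M%:R :> R by rewrite ltr0n.
(* The p-th root of [kap] is k0^(1/q) M^(-1/2), the factor in the statement. *)
pose kap := (k0 * M%:R `^ (- (q / 2))) `^ (p / q).
have kap0 : (0 <= kap%:E)%E by rewrite lee_fin powR_ge0.
have Tle n : (\int[mu]_s ((\int[P]_w (`|T n w s| `^ q)%:E) `^ (p / q)) <=
    kap%:E * \int[mu]_s h s)%E.
  rewrite -ge0_integralZl//.
  apply: (@integral_piecewise_le _ _ _ mu (restricted (K n) (Bs n))).
  - by move=> k; apply: measurable_restricted => i; exact: mBs.
  - exact: trivIset_restricted (dB n).
  - apply: (@measurableT_comp _ _ _ _ _ _ (fun x => poweR x (p / q))).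
      exact: measurable_poweR.
    apply: (measurable_fun_fubini_tonelli_G (fun z : Om * S => (`|T n z.1 z.2| `^ q)%:E)).
      exact: measurable_normr_powR.
    by move=> z; rewrite lee_fin powR_ge0.
  - exact: measurable_funeM.
  - by move=> s; exact: poweR_ge0.
  - by move=> s; rewrite mule_ge0.
  - move=> s Us; under eq_integral.
      move=> w _; rewrite /T step_out; last by move=> k Kk Bk; apply: Us; exists k.
      rewrite normr0 powR0 ?gt_eqF//; over.
    by rewrite integral0 poweR0r// mulf_neq0 ?invr_neq0 ?gt_eqF.
  move=> k; have [Kk|Kk] := pselect (K n k); last first.
    have -> : restricted (K n) (Bs n) k = set0 by apply/seteqP; split => s // [].
    by rewrite !integral_set0.
  have -> : restricted (K n) (Bs n) k = Bs n k by apply/seteqP; split => s // [].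
  have [mB [B0 By]] := HB n k Kk.
  rewrite ge0_integralZl//; last exact: measurable_funS mh.
  apply: le_trans (moment_block M0 mB B0 By).
  rewrite le_eqVlt; apply/orP; left; apply/eqP.
  pose c := ((\int[P]_w (`|W M (Bs n k) w| `^ q)%:E) `^ (p / q))%E.
  transitivity (\int[mu]_(s in Bs n k) cst c s)%E; last exact: integral_cst.
  apply: eq_integral => s /set_mem sB; rewrite /cst /c.
  congr (poweR _ _); apply: eq_integral => w _.
  by rewrite /T (step_in _ (dB n) Kk sB).
set bound := (X in (_ <= X)%E).
have Tbound n : (normLqLp P mu q p (T n) <= bound)%E.
  apply: le_trans (normLqLp_le_normLpLq P mu p1 pq (mT n)) _.
  rewrite normLpLqE; apply: le_trans (le_poweR _ _ (Tle n)) _.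
  - by rewrite invr_ge0 ltW.
  - by apply: integral_ge0 => s _; exact: poweR_ge0.
  rewrite poweRM//; last exact: integral_ge0.
  rewrite /bound normLpLqE le_eqVlt; apply/orP; left; apply/eqP; congr (_ * _)%E.
  rewrite poweR_EFin /kap -powRrM; congr EFin.
  rewrite powRM ?powR_ge0 ?(ltW k0_gt0)// -powRrM.
  by congr (_ `^ _ * _ `^ _); field; rewrite !gt_eqF.
have bound0 : (0 <= bound)%E.
  by rewrite mule_ge0 ?poweR_ge0// lee_fin mulr_ge0 ?powR_ge0.
have aeY : {ae P, forall w, forall j, (normLpS mu p (Y j w) < +oo)%E}.
  by apply: ae_foralln => j; exact: (YL j).2.
(* The averaging property concerns functions in L^p(S), so the error must first be placed there for
   almost every outcome. *)
have aeErr : {ae P, forall w, (normLpS mu p (err M w) < +oo)%E}.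
  apply: filterS aeY => w Yw.
  have sumfin r : (normLpS mu p (fun s => \sum_(j <- r) Y j w s)%R < +oo)%E.
    elim: r => [|j r IH].
      rewrite (_ : (fun _ => _) = cst 0); last by apply/funext => s; rewrite big_nil.
      rewrite normLpS_lty//; under eq_integral do rewrite normr0 powR0 ?gt_eqF//.
      by rewrite integral0.
    have := @minkowski_EFin _ _ _ mu (Y j w) (fun s => \sum_(j <- r) Y j w s) p.
    move=> /(_ (measurable_joint1 w (mY j))) => /(_ _ p1).
    have ms : measurable_fun setT (fun s => \sum_(j <- r) Y j w s).
      by apply: measurable_sum => i; exact: (measurable_joint1 w (mY i)).
    move=> /(_ ms) hm; apply: le_lt_trans (lte_add_pinfty (Yw j) IH).
    by apply: le_trans hm; rewrite /normLpS; under eq_Lnorm do rewrite /= big_cons.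
  have mYw := measurable_sum (index_iota 1 M.+1)
    (fun j => measurable_joint1 w (mY j)) (D := setT).
  have Sfin := sumfin (index_iota 1 M.+1).
  have mErr := measurable_joint1 w (merr M).
  apply: le_lt_trans (normLpS_triangle mu p1 mErr mm) _.
  have nE f := @normLpS_lty _ _ _ mu p f p0.
  apply: lte_add_pinfty; first by rewrite nE; exact: level_mean_Lp.
  rewrite nE; rewrite nE in Sfin; apply: le_lt_trans Sfin.
  apply: ge0_le_integral => //.
  - apply: measurable_normr_powR; exact: measurable_funB.
  - exact: measurable_normr_powR.
  move=> s _; rewrite lee_fin; apply: ge0_ler_powR; rewrite ?nnegrE ?(ltW p0)//.
  rewrite /err opprB addrC subrK normrM ler_piMl// ger0_norm ?invr_ge0//.
  by rewrite invf_le1// ler1n.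
have aeliminf : {ae P, forall w, (normLpS mu p (err M w) `^ q <=
    limn_einf (fun n => normLpS mu p (T n w) `^ q))%E}.
  apply: filterS2 aeY aeErr => w Yw Ew.
  have mErr := measurable_joint1 w (merr M).
  apply: normLpS_le_liminf => //.
  - by move=> n; exact: (measurable_joint1 w (mT n)).
  - by rewrite -normLpS_lty.
  have := @averaging_real _ _ _ mu K Bs HB dB H p (err M w) p1 mErr.
  have nE f := @normLpS_lty _ _ _ mu p f p0.
  rewrite -nE => /(_ Ew) conv.
  (* At such an outcome the pairing form of the coefficients agrees with the averages of the error
     on all blocks and for all n. *)
  suff TE n : step (K n) (Bs n) (averages mu (Bs n) (err M w)) = T n w.
    rewrite [X in X @ _ --> _](_ : _ = fun n => \int[mu]_s
      (`|step (K n) (Bs n) (averages mu (Bs n) (err M w)) s - err M w s| `^ p)%:E)%E.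
      exact: conv.
    by apply/funext => n; rewrite TE.
  apply/funext => s; rewrite /T; have [[k [Kk Bk]]|Hk] := pselect (exists k, K n k /\ Bs n k s).
    rewrite !(step_in _ (dB n) Kk Bk) /C; have [mB [_ By]] := HB n k Kk.
    exact: average_err.
  by rewrite !step_out// => k Kk Bk; apply: Hk; exists k.
have mN n : measurable_fun setT (fun w => normLpS mu p (T n w) `^ q)%E.
  apply: (@measurableT_comp _ _ _ _ _ _ (fun x => poweR x q)).
    exact: measurable_poweR.
  exact: measurable_normLpS.
have boundE : bound = ((bound `^ q) `^ q^-1)%E.
  by rewrite -poweRrM mulfV ?gt_eqF// poweRe1.
rewrite /normLqLp [leRHS]boundE.
apply: le_poweR; first by rewrite invr_ge0 ltW.
  by apply: integral_ge0 => w _; exact: poweR_ge0.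
(* Lower semicontinuity under the integral, then Fatou, then the bound [Tbound], which does not
   depend on n. *)
apply: (@le_trans _ _ (\int[P]_w limn_einf (fun n => normLpS mu p (T n w) `^ q))%E).
  apply: ae_ge0_le_integral => //.
  - by move=> w _; exact: poweR_ge0.
  - apply: (@measurableT_comp _ _ _ _ _ _ (fun x => poweR x q)).
      exact: measurable_poweR.
    exact: (measurable_normLpS mu p (merr M)).
  - move=> w _; rewrite -[leLHS](limn_einf_cst 0%E).
    by apply: le_limn_einf; apply: nearW => n; exact: poweR_ge0.
  - apply: measurableT_comp => //; apply: measurable_fun_limn_esup => n.
    exact: measurableT_comp.
  by apply: filterS aeliminf => w h' _.
apply: le_trans (fatou P measurableT mN _) _; first by move=> n w _; exact: poweR_ge0.
rewrite -[leRHS](limn_einf_cst (bound `^ q)%E).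
apply: le_limn_einf; apply: nearW => n.
have := le_poweR (ltW q0) (normLqLp_ge0 _ _ _ _ _) (Tbound n).
rewrite {1}/normLqLp -poweRrM mulVf ?gt_eqF// poweRe1//.
by apply: integral_ge0 => w _; exact: poweR_ge0.
Qed.

End LevelError.

(** * Numbers of levels and of samples *)


Section Complexity.
Context {R : realType}.
Variable A : R.
Hypothesis A1 : 1 < A.
Implicit Types (kappa : R) (L : nat).

Let A0 : 0 < A. Proof. exact: lt_trans ltr01 A1. Qed.
Let AN0 : A != 0. Proof. by rewrite gt_eqF. Qed.

(** For kappa > 0, the sum over l >= 0 of A^(-kappa l). *)
Definition geom_const kappa : R := (1 - A `^ (- kappa))^-1.

Lemma geom_ratio_lt1 kappa : 0 < kappa -> A `^ (- kappa) < 1.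
Proof.
move=> k0; rewrite powRN invf_lt1 ?powR_gt0//.
by rewrite -[ltLHS](powRr0 A) /powR (gt_eqF A0) ltr_expR ltr_pM2r ?ln_gt0.
Qed.

Lemma geom_const_gt0 kappa : 0 < kappa -> 0 < geom_const kappa.
Proof. by move=> k0; rewrite invr_gt0 subr_gt0 geom_ratio_lt1. Qed.

Lemma geom_constE kappa : 0 < kappa ->
  geom_const kappa * (1 - A `^ (- kappa)) = 1.
Proof. by move=> k0; rewrite mulVf// subr_eq0 gt_eqF// geom_ratio_lt1. Qed.

Lemma powR_natS kappa n : A `^ (kappa * n.+1%:R) = A `^ (kappa * n%:R) * A `^ kappa.
Proof. by rewrite -natr1 mulrDr mulr1 powRD// AN0 implybT. Qed.

(** Read backwards from its last term, the growing sum is part of a convergent geometric series. *)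
Lemma geom_sum_up kappa L : 0 < kappa ->
  \sum_(1 <= l < L.+1) A `^ (kappa * l%:R) <= geom_const kappa * A `^ (kappa * L%:R).
Proof.
move=> k0; have g0 := geom_const_gt0 k0; have gE := geom_constE k0.
elim: L => [|L IH].
  by rewrite big_geq// mulr_ge0 ?powR_ge0// ltW.
rewrite big_nat_recr//= powR_natS.
have E : A `^ (- kappa) * A `^ kappa = 1 by rewrite powRN mulVf// gt_eqF// powR_gt0.
set x := A `^ (kappa * L%:R) in IH *; set y := A `^ kappa in E *.
have y0 : 0 < y by rewrite powR_gt0.
have : geom_const kappa * (y - 1) = y.
  transitivity (y * (geom_const kappa * (1 - A `^ (- kappa)))); last by rewrite gE mulr1.
  by rewrite -[in LHS]E; ring.
move=> h; have -> : geom_const kappa * (x * y) = geom_const kappa * x + x * (geom_const kappa * (y - 1)).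
  by ring.
by rewrite h lerD2r.
Qed.

Lemma geom_sum_down kappa L : 0 < kappa ->
  \sum_(1 <= l < L.+1) A `^ (- kappa * l%:R) <= geom_const kappa.
Proof.
move=> k0; have g0 := geom_const_gt0 k0; have gE := geom_constE k0.
(* The bound is sharpened by the remaining tail, otherwise the induction on L would not close. *)
suff : \sum_(1 <= l < L.+1) A `^ (- kappa * l%:R) <=
    geom_const kappa * (1 - A `^ (- kappa * L%:R)).
  move=> /le_trans; apply; rewrite ler_piMr ?(ltW g0)//.
  by rewrite gerBl powR_ge0.
elim: L => [|L IH]; first by rewrite big_geq// mulr0 powRr0 subrr mulr0.
rewrite big_nat_recr//= powR_natS.
set x := A `^ (- kappa * L%:R) in IH *; set r := A `^ (- kappa) in gE *.
have x0 : 0 <= x := powR_ge0 _ _.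
have r0 : 0 <= r := powR_ge0 _ _.
have r1 : r <= 1 by rewrite ltW// geom_ratio_lt1.
have E : geom_const kappa * (1 - x * r) =
    geom_const kappa * (1 - x) + x * (geom_const kappa * (1 - r)) by ring.
rewrite E gE mulr1; apply: lerD => //.
by rewrite ler_piMr.
Qed.

(** Level l receives the share (eps/2) w_l of the error. The real number y_l^2 of samples would
    spend this share exactly; M_l is its integer part plus one. In the cost, M_l <= 1 + y_l^2: the 1
    produces the first sum, y_l^2 the second. *)
Lemma sample_sizes (eps B2 beta gamma : R) L (w : nat -> R) :
  0 < eps -> 0 < B2 -> (forall l, 0 < w l) ->
  \sum_(1 <= l < L.+1) w l <= 1 ->
  exists M : nat -> nat, (forall l, (0 < M l)%N) /\
  \sum_(1 <= l < L.+1) B2 * (M l)%:R `^ (- 2^-1) * A `^ (- beta * l%:R) <= eps / 2 /\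
  \sum_(1 <= l < L.+1) (M l)%:R * A `^ (gamma * l%:R) <=
  \sum_(1 <= l < L.+1) A `^ (gamma * l%:R) +
  (2 * B2) ^+ 2 * eps `^ (-2) *
    \sum_(1 <= l < L.+1) A `^ ((gamma - 2 * beta) * l%:R) / w l ^+ 2.
Proof.
move=> e0 B0 w0 sw.
pose y l := 2 * B2 * A `^ (- beta * l%:R) / (eps * w l).
have y0 l : 0 < y l by rewrite divr_gt0 ?mulr_gt0// powR_gt0.
have y20 l : 0 <= y l ^+ 2 by exact: sqr_ge0.
exists (fun l => (Num.truncn (y l ^+ 2)).+1); split => //; split.
  apply: (@le_trans _ _ (\sum_(1 <= l < L.+1) eps / 2 * w l)); last first.
    by rewrite -big_distrr/= ler_piMr// divr_ge0// ltW.
  apply: ler_sum => l _.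
  set M := (Num.truncn _).+1.
  have yM : y l ^+ 2 <= M%:R by rewrite ltW// truncnS_gt.
  have yM' : y l <= M%:R `^ 2^-1.
    by rewrite powR12_sqrt// -[leLHS]gtr0_norm// -sqrtr_sqr ler_sqrt.
  rewrite powRN; apply: (@le_trans _ _ (B2 * (y l)^-1 * A `^ (- beta * l%:R))).
    apply: ler_wpM2r; first exact: powR_ge0.
    apply: ler_wpM2l; first exact: ltW.
    by rewrite lef_pV2 ?posrE// (lt_le_trans (y0 l)).
  rewrite le_eqVlt; apply/orP; left; apply/eqP; rewrite /y.
  have a0 : A `^ (- beta * l%:R) != 0 by rewrite gt_eqF// powR_gt0.
  by field; rewrite a0 !gt_eqF.
rewrite big_distrr/= -big_split/=; apply: ler_sum => l _.
set M := (Num.truncn _).+1.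
have yM : M%:R <= 1 + y l ^+ 2.
  by rewrite /M -natr1 addrC lerD2l truncn_le.
apply: (le_trans (ler_wpM2r (powR_ge0 _ _) yM)).
rewrite mulrDl mul1r lerD2l le_eqVlt; apply/orP; left; apply/eqP.
have -> : A `^ ((gamma - 2 * beta) * l%:R) = A `^ (gamma * l%:R) * A `^ (- beta * l%:R) ^+ 2.
  rewrite expr2 -!powRD ?AN0 ?implybT//; congr (_ `^ _); ring.
have -> : eps `^ (-2) = (eps ^+ 2)^-1.
  by rewrite powRN -powR_mulrn// ltW.
by rewrite /y; field; rewrite !gt_eqF.
Qed.

(** L is the least integer above the x with c A^(-alpha x) = eps. Rounding up costs the factor A in
    [K1]. The summand 1 in c = 4 B1 + 1 makes ln c nonnegative, and eps <= 1/2 gives ln 2 <= -ln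
    eps, which turns the additive constants of x + 1 into a multiple of the logarithm. *)
Lemma number_of_levels (alpha B1 : R) : 0 < alpha -> 0 < B1 ->
  exists K1 K2 : R, 0 < K1 /\ 0 < K2 /\ forall eps, 0 < eps -> eps <= 1 / 2 ->
  exists L, (0 < L)%N /\ B1 * A `^ (- alpha * L%:R) <= eps / 4 /\
    A `^ L%:R <= K1 * eps `^ (- alpha^-1) /\ L%:R <= K2 * `|ln eps / ln A|.
Proof.
move=> a0 B0; pose c := 4 * B1 + 1.
have c0 : 0 < c by rewrite /c; lra.
have lnA : 0 < ln A by rewrite ln_gt0.
have ln2 : 0 < ln 2 :> R by rewrite ln_gt0//; lra.
have lnc : 0 <= ln c by rewrite ln_ge0// /c; lra.
have al : 0 < alpha * ln A by rewrite mulr_gt0.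
pose k := ln c / (alpha * ln A) + 1.
have k0 : 0 < k by rewrite ltr_wpDl// divr_ge0// ltW.
exists (A * c `^ alpha^-1), (k * (ln A / ln 2) + alpha^-1); split.
  by rewrite mulr_gt0// powR_gt0.
split; first by rewrite addr_gt0 ?invr_gt0// mulr_gt0// divr_gt0.
move=> eps e0 e1.
have lne : ln 2 <= - ln eps.
  by rewrite -lnV ?posrE// ler_ln ?posrE ?invr_gt0// -[2]invrK lef_pV2 ?posrE//; lra.
pose x := (ln c - ln eps) / (alpha * ln A).
have x0 : 0 <= x by rewrite divr_ge0 ?(ltW al)//; lra.
have AE y : A `^ y = expR (y * ln A) by rewrite /powR (negbTE AN0).
exists (Num.truncn x).+1; split => //.
have xL : x < (Num.truncn x).+1%:R by rewrite truncnS_gt.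
have Lx : (Num.truncn x).+1%:R <= x + 1 by rewrite -natr1 lerD2r truncn_le.
set L := (Num.truncn x).+1 in xL Lx *.
have xE : alpha * ln A * x = ln c - ln eps by rewrite /x mulrCA mulfV ?mulr1// gt_eqF.
split.
  apply: (@le_trans _ _ (B1 * (eps / c))).
    apply: ler_wpM2l; first exact: ltW.
    rewrite AE -[eps / c]lnK ?posrE ?divr_gt0// ler_expR ln_div ?posrE//.
    have : alpha * ln A * x <= alpha * ln A * L%:R by rewrite ler_wpM2l// ltW.
    by rewrite xE; lra.
  rewrite mulrA ler_pdivrMr//; have : 0 < eps * B1 by rewrite mulr_gt0.
  by rewrite /c; lra.
split.
  have -> : A * c `^ alpha^-1 * eps `^ (- alpha^-1) = A `^ (x + 1).
    rewrite powRD ?AN0 ?implybT// powRr1 ?(ltW A0)// [RHS]mulrC -mulrA; congr (_ * _).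
    rewrite AE /powR !gt_eqF// -expRD; congr expR.
    by rewrite /x; field; rewrite !gt_eqF.
  by rewrite ler_powR// ltW.
apply: (le_trans Lx).
have -> : `|ln eps / ln A| = - ln eps / ln A.
  by rewrite normrM normfV ler0_norm ?gtr0_norm//; lra.
have -> : x + 1 = k + alpha^-1 * (- ln eps / ln A).
  by rewrite /x /k; field; rewrite !gt_eqF.
rewrite [leRHS]mulrDl lerD2r.
have -> : k * (ln A / ln 2) * (- ln eps / ln A) = k * (- ln eps / ln 2).
  by field; rewrite !gt_eqF.
by rewrite ler_peMr ?(ltW k0)// ler_pdivlMr// mul1r.
Qed.

(** Bias at most eps/4 and sampling error at most eps/2 leave the strict inequality. The regimes
    differ only in the sum over y_l^2; the cost of rounding up is a geometric sum of order A^(gamma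
    L), that is, eps^(-gamma/alpha). *)
Lemma mlmc_complexity (alpha beta gamma B1 B2 : R) :
  0 < alpha -> 0 < gamma -> 0 < B1 -> 0 < B2 ->
  exists K, 0 < K /\ forall eps, 0 < eps -> eps <= 1 / 2 ->
  exists L (M : nat -> nat), (0 < L)%N /\ (forall l, (0 < M l)%N) /\
    B1 * A `^ (- alpha * L%:R) +
    \sum_(1 <= l < L.+1) B2 * (M l)%:R `^ (- 2^-1) * A `^ (- beta * l%:R) < eps /\
    \sum_(1 <= l < L.+1) (M l)%:R * A `^ (gamma * l%:R) <=
      K * mlmc_rate A alpha beta gamma eps.
Proof.
move=> a0 g0 B10 B20.
have [K1 [K2 [K10 [K20 HL]]]] := number_of_levels a0 B10.
(* [w l] is the share of the sampling error [eps / 2] allotted to level [l]: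
   geometric, decreasing or increasing in [l], in the two strict cases, and
   constant when [beta = gamma / 2]. *)
suff [K3 [K30 HW]] : exists K3, 0 < K3 /\ forall eps L, 0 < eps -> eps <= 1 / 2 ->
    (0 < L)%N -> A `^ L%:R <= K1 * eps `^ (- alpha^-1) ->
    L%:R <= K2 * `|ln eps / ln A| ->
    exists w : nat -> R, (forall l, 0 < w l) /\ \sum_(1 <= l < L.+1) w l <= 1 /\
    eps `^ (-2) * \sum_(1 <= l < L.+1) A `^ ((gamma - 2 * beta) * l%:R) / w l ^+ 2 <=
    K3 * (if gamma / 2 < beta then eps `^ (-2)
          else if beta == gamma / 2 then eps `^ (-2) * `|ln eps / ln A| ^+ 3
          else eps `^ (-2 - (gamma - 2 * beta) / alpha)).
  pose K0 := geom_const gamma * K1 `^ gamma.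
  have K00 : 0 < K0 by rewrite mulr_gt0 ?powR_gt0// geom_const_gt0.
  have K40 : 0 < (2 * B2) ^+ 2 * K3 by rewrite mulr_gt0// exprn_gt0// mulr_gt0.
  exists (K0 + (2 * B2) ^+ 2 * K3); split; first exact: addr_gt0.
  move=> eps e0 e1; have [L [L0 [bias [AL LL]]]] := HL eps e0 e1.
  have [w [w0 [sw Hw]]] := HW eps L e0 e1 L0 AL LL.
  have [M [M0 [err cost]]] := sample_sizes beta gamma e0 B20 w0 sw.
  exists L, M; split => //; split => //; split; first lra.
  apply: (le_trans cost); rewrite /mlmc_rate mulrDr.
  set r1 := eps `^ (- (gamma / alpha)); set r2 := (X in _ <= _ + _ * X).
  have r10 : 0 <= r1 := powR_ge0 _ _.
  have r20 : 0 <= r2.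
    rewrite /r2; case: ifP => _; first exact: powR_ge0.
    by case: ifP => _; rewrite ?mulr_ge0 ?powR_ge0// exprn_ge0.
  have C1 : \sum_(1 <= l < L.+1) A `^ (gamma * l%:R) <= K0 * r1.
    apply: (le_trans (geom_sum_up L g0)); rewrite /K0 -mulrA.
    apply: ler_wpM2l; first by rewrite ltW// geom_const_gt0.
    rewrite mulrC powRrM; apply: (@le_trans _ _ ((K1 * eps `^ (- alpha^-1)) `^ gamma)).
      by apply: ge0_ler_powR; rewrite ?nnegrE ?mulr_ge0 ?powR_ge0// ltW.
    rewrite powRM ?powR_ge0 ?(ltW K10)// -powRrM.
    by rewrite /r1 mulNr (mulrC alpha^-1).
  have C2 := ler_wpM2l (ltW (exprn_gt0 2 (mulr_gt0 (ltr0Sn R 1) B20))) Hw.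
  rewrite -/r2 in C2.
  have h1 := mulr_ge0 (ltW K40) r10; have h2 := mulr_ge0 (ltW K00) r20.
  rewrite mulrA in C2; lra.
have [bg|bg] := ltP (gamma / 2) beta.
  (* Weights decaying like A^(-kap l/4) enter squared and use half of the decay A^(-kap l); the
     other half keeps the cost sum bounded in L. *)
  pose kap := 2 * beta - gamma.
  have k4 : 0 < kap / 4 by rewrite /kap; lra.
  have k2 : 0 < kap / 2 by rewrite /kap; lra.
  have g1 := geom_const_gt0 k4; have g2 := geom_const_gt0 k2.
  exists (geom_const (kap / 4) ^+ 2 * geom_const (kap / 2)); split.
    by rewrite mulr_gt0// exprn_gt0.
  move=> eps L e0 _ L0 AL LL; exists (fun l => A `^ (- (kap / 4) * l%:R) / geom_const (kap / 4)).
  split; first by move=> l; rewrite divr_gt0// powR_gt0.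
  split; first by rewrite -big_distrl/= ler_pdivrMr// mul1r geom_sum_down.
  rewrite mulrC; apply: ler_wpM2r; first exact: powR_ge0.
  apply: (@le_trans _ _ (\sum_(1 <= l < L.+1)
      geom_const (kap / 4) ^+ 2 * A `^ (- (kap / 2) * l%:R))); last first.
    rewrite -big_distrr/=; apply: ler_wpM2l; first by rewrite exprn_ge0// ltW.
    exact: geom_sum_down.
  apply: ler_sum => l _; rewrite le_eqVlt; apply/orP; left; apply/eqP.
  have -> : A `^ ((gamma - 2 * beta) * l%:R) =
      A `^ (- (kap / 2) * l%:R) * A `^ (- (kap / 4) * l%:R) ^+ 2.
    by rewrite expr2 -!powRD ?AN0 ?implybT//; congr (_ `^ _); rewrite /kap; field.
  have a4 : A `^ (- (kap / 4) * l%:R) != 0 by rewrite gt_eqF// powR_gt0.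
  by field; rewrite a4 gt_eqF.
case: (eqVneq beta (gamma / 2)) => [bE|bN].
  (* With w_l = 1/L the sum consists of L terms equal to L^2, and L is at most [K2] times the
     logarithm. *)
  exists (K2 ^+ 3); split; first exact: exprn_gt0.
  move=> eps L e0 _ L0 AL LL; exists (fun=> L%:R^-1).
  have L0' : 0 < L%:R :> R by rewrite ltr0n.
  split; first by move=> _; rewrite invr_gt0.
  split.
    rewrite big_const_nat subSS subn0 iter_addr addr0 -[leLHS]mulr_natr mulVf//.
    by rewrite gt_eqF.
  rewrite mulrCA; apply: ler_wpM2l; first exact: powR_ge0.
  have -> : (gamma - 2 * beta) = 0 by rewrite bE; field.
  under eq_bigr do rewrite mul0r powRr0 div1r exprVn invrK.
  rewrite big_const_nat subSS subn0 iter_addr addr0 -[leLHS]mulr_natr -exprSr.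
  by rewrite -exprMn lerXn2r// nnegrE ?mulr_ge0// ltW.
pose kap := gamma - 2 * beta.
have kp : 0 < kap by move: bg; rewrite le_eqVlt (negbTE bN)/= /kap; lra.
have k4 : 0 < kap / 4 by lra.
have k2 : 0 < kap / 2 by lra.
have g1 := geom_const_gt0 k4; have g2 := geom_const_gt0 k2.
exists (geom_const (kap / 4) ^+ 2 * geom_const (kap / 2) * K1 `^ kap); split.
  by rewrite !mulr_gt0// ?exprn_gt0 ?powR_gt0.
move=> eps L e0 _ L0 AL LL.
(* Normalized by the last level, these weights contribute A^(kap L/2), and the remaining sum of
   A^(kap l/2) as much again; A^(kap L) is of order eps^(-kap/alpha). *)
exists (fun l => A `^ (kap / 4 * l%:R) / (geom_const (kap / 4) * A `^ (kap / 4 * L%:R))).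
have aL : 0 < A `^ (kap / 4 * L%:R) by rewrite powR_gt0.
split; first by move=> l; rewrite divr_gt0 ?mulr_gt0// powR_gt0.
split; first by rewrite -big_distrl/= ler_pdivrMr ?mulr_gt0// mul1r geom_sum_up.
have -> : eps `^ (-2 - kap / alpha) = eps `^ (-2) * eps `^ (- (kap / alpha)).
  by rewrite -powRD// (gt_eqF e0) implybT.
rewrite mulrCA; apply: ler_wpM2l; first exact: powR_ge0.
apply: (@le_trans _ _ (geom_const (kap / 4) ^+ 2 * geom_const (kap / 2) * A `^ (kap * L%:R))).
  apply: (@le_trans _ _ (\sum_(1 <= l < L.+1) (geom_const (kap / 4) ^+ 2 *
      A `^ (kap / 2 * L%:R)) * A `^ (kap / 2 * l%:R))).
    apply: ler_sum => l _; rewrite le_eqVlt; apply/orP; left; apply/eqP.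
    have E n : A `^ (kap / 2 * n) = A `^ (kap / 4 * n) ^+ 2.
      by rewrite expr2 -powRD ?AN0 ?implybT//; congr (_ `^ _); field.
    have -> : A `^ (kap * l%:R) = A `^ (kap / 2 * l%:R) ^+ 2.
      by rewrite expr2 -powRD ?AN0 ?implybT//; congr (_ `^ _); field.
    rewrite !E.
    have a4 : A `^ (kap / 4 * l%:R) != 0 by rewrite gt_eqF// powR_gt0.
    by field; rewrite a4 !gt_eqF.
  have -> : A `^ (kap * L%:R) = A `^ (kap / 2 * L%:R) * A `^ (kap / 2 * L%:R).
    by rewrite -powRD ?AN0 ?implybT//; congr (_ `^ _); field.
  have G2 : 0 <= geom_const (kap / 4) ^+ 2 * A `^ (kap / 2 * L%:R).
    by rewrite mulr_ge0 ?powR_ge0// exprn_ge0// ltW.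
  rewrite -big_distrr/=; have := ler_wpM2l G2 (geom_sum_up L k2); lra.
rewrite -[leRHS]mulrA; apply: ler_wpM2l; first by rewrite mulr_ge0 ?exprn_ge0// ltW.
rewrite mulrC powRrM; apply: (@le_trans _ _ ((K1 * eps `^ (- alpha^-1)) `^ kap)).
  by apply: ge0_ler_powR; rewrite ?nnegrE ?mulr_ge0 ?powR_ge0// ltW.
rewrite powRM ?powR_ge0 ?(ltW K10)// -powRrM.
by rewrite mulNr (mulrC alpha^-1).
Qed.

End Complexity.

(** * Multilevel estimator *)


Section Telescope.
Context {R : realType} {dO dS : measure_display}
  {Om : measurableType dO} {S : measurableType dS}.
Variables (P : probability Om R) (mu : {sigma_finite_measure set S -> \bar R}).
Implicit Types (p q : R).

Lemma expect0 (s : S) : expect P (fun _ _ => 0 : R) s = 0 :> R.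
Proof. by rewrite /expect integral0. Qed.

Lemma measurable_expect (Y : Om -> S -> R) :
  measurable_fun setT (fun z : Om * S => Y z.1 z.2) ->
  measurable_fun setT (expect P Y : S -> R).
Proof.
move=> mY; apply: (measurableT_comp (fine_measurable measurableT)).
pose f (z : Om * S) := (Y z.1 z.2)%:E.
have mf : measurable_fun setT f by exact/measurable_EFinP.
have -> : (fun s => \int[P]_w (Y w s)%:E)%E =
    (fun s => fubini_G P f^\+ s - fubini_G P f^\- s)%E.
  apply/funext => s; rewrite -[fun w => _]/(f \o pair^~ s) integralE.
  by rewrite funepos_comp funeneg_comp.
apply: (@emeasurable_funB _ _ _ _ (fubini_G P f^\+)%E (fubini_G P f^\-)%E).
  by apply: measurable_fun_fubini_tonelli_G => //; exact: measurable_funepos.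
by apply: measurable_fun_fubini_tonelli_G => //; exact: measurable_funeneg.
Qed.

(** Makes [expect] a true expectation at almost every s; elsewhere [fine] may return a default
    value. *)
Lemma in_LpLq_ae_integrable p q (Y : Om -> S -> R) : 1 <= p -> 1 <= q ->
  in_LpLq P mu p q Y ->
  {ae mu, forall s, P.-integrable setT (fun w => (Y w s)%:E)}.
Proof.
move=> p1 q1 [[mY _] Yfin]; have p0 : 0 < p by lra.
have q0 : 0 < q by lra.
move: Yfin; rewrite normLpLqE => /(lty_poweRy (invr_neq0 (lt0r_neq0 p0))) Yfin.
have mh : measurable_fun setT
    (fun s => (\int[P]_w (`|Y w s| `^ q)%:E) `^ (p / q))%E.
  apply: (@measurableT_comp _ _ _ _ _ _ (fun x => poweR x (p / q))).
    exact: measurable_poweR.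
  apply: (measurable_fun_fubini_tonelli_G (fun z : Om * S => (`|Y z.1 z.2| `^ q)%:E)).
    exact: measurable_normr_powR.
  by move=> z; rewrite lee_fin powR_ge0.
have Ih : mu.-integrable setT (fun s => (\int[P]_w (`|Y w s| `^ q)%:E) `^ (p / q))%E.
  by apply/integrableP; split => //; under eq_integral do rewrite gee0_abs ?poweR_ge0//.
apply: filterS (integrable_ae measurableT Ih) => s /(_ I).
rewrite ge0_fin_numE ?poweR_ge0// => /(lty_poweRy (_ : p / q != 0)) Ys.
apply: (integrable_powR q1) => //.
- exact: (measurable_joint2 s mY).
- by apply: le_lt_trans (probability_le1 P measurableT) _; rewrite ltry.
by apply: Ys; rewrite mulf_neq0 ?invr_neq0 ?gt_eqF.
Qed.

Lemma LpS_rvB p (Y Z : Om -> S -> R) : 1 <= p ->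
  LpS_rv P mu p Y -> LpS_rv P mu p Z -> LpS_rv P mu p (fun w s => Y w s - Z w s).
Proof.
move=> p1 [mY Yp] [mZ Zp]; split; first exact: measurable_funB.
apply: filterS2 Yp Zp => w Yw Zw.
have mYw := measurable_joint1 w mY; have mZw := measurable_joint1 w mZ.
have mD : measurable_fun setT (fun s => Y w s - Z w s) by exact: measurable_funB.
apply: le_lt_trans (normLpS_triangle mu p1 mD mYw) _.
apply: lte_add_pinfty => //.
by rewrite (_ : (fun s => _) = Z w)//; apply/funext => s; rewrite opprB addrC subrK.
Qed.

Lemma normLpS_cst0 p : 0 < p -> normLpS mu p (fun=> 0) = 0%E.
Proof.
move=> p0; rewrite normLpSE; under eq_integral do rewrite normr0 powR0 ?gt_eqF//.
by rewrite integral0 poweR0r// invr_neq0// gt_eqF.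
Qed.

Lemma in_LpLq_cst0 p q : 0 < p -> 0 < q -> in_LpLq P mu p q (fun _ _ => 0).
Proof.
move=> p0 q0; split.
  by split => //; apply: nearW => w; rewrite normLpS_cst0.
rewrite normLpLqE (_ : (fun s => _) = cst 0%E) ?integral0 ?poweR0r ?invr_neq0 ?gt_eqF//.
apply/funext => s; under eq_integral do rewrite normr0 powR0 ?gt_eqF//.
by rewrite integral0 poweR0r// mulf_neq0 ?invr_neq0 ?gt_eqF.
Qed.

Lemma normLqLp_sum_le q p (r : seq nat) (F : nat -> Om -> S -> R) : 1 <= p -> 1 <= q ->
  (forall l, measurable_fun setT (fun z : Om * S => F l z.1 z.2)) ->
  (normLqLp P mu q p (fun w s => \sum_(l <- r) F l w s)%R <=
   \sum_(l <- r) normLqLp P mu q p (F l))%E.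
Proof.
move=> p1 q1 mF; have p0 := lt_le_trans ltr01 p1; have q0 := lt_le_trans ltr01 q1.
elim: r => [|l r IH].
  rewrite big_nil (_ : (fun _ _ => _) = (fun _ => cst 0)).
    by rewrite normLqLp_cst// normLpS_cst0.
  by apply/funext => w; apply/funext => s; rewrite big_nil.
rewrite big_cons; apply: le_trans (leeD2l _ IH).
have mS : measurable_fun setT (fun z : Om * S => \sum_(i <- r) F i z.1 z.2).
  by apply: measurable_sum => i; exact: mF.
apply: le_trans (normLqLp_triangle P mu p1 q1 (mF l) mS).
rewrite (_ : (fun w s => \sum_(i <- l :: r) F i w s) =
  (fun w s => F l w s + \sum_(i <- r) F i w s))//.
by apply/funext => w; apply/funext => s; rewrite big_cons.
Qed.

(** Linearity of the expectation, legitimate at almost every s, where Y and Z are both integrable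
    over Omega. *)
Lemma mean_increment0 p q (Y Z : Om -> S -> R) : 1 <= p -> 1 <= q ->
  in_LpLq P mu p q Y -> in_LpLq P mu p q Z ->
  {ae mu, forall s, (\int[P]_w
     ((Y w s - Z w s) - (expect P Y s - expect P Z s))%:E = 0)%E}.
Proof.
move=> p1 q1 hY hZ.
apply: filterS2 (in_LpLq_ae_integrable p1 q1 hY) (in_LpLq_ae_integrable p1 q1 hZ).
move=> s IY IZ; rewrite /expect.
have fY : (\int[P]_w (Y w s)%:E)%E \is a fin_num by exact: integrable_fin_num.
have fZ : (\int[P]_w (Z w s)%:E)%E \is a fin_num by exact: integrable_fin_num.
set a := fine _; set b := fine _.
have IYZ : P.-integrable setT (EFin \o (fun w => Y w s - Z w s)).
  exact: (integrableB measurableT IY IZ).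
have Ic : P.-integrable setT (EFin \o cst (a - b)).
  exact: finite_measure_integrable_cst.
transitivity (\int[P]_w (Y w s - Z w s)%:E - \int[P]_w (a - b)%:E)%E.
  exact: (integralB_EFin measurableT IYZ Ic).
rewrite integral_cst_probability.
transitivity ((\int[P]_w (Y w s)%:E - \int[P]_w (Z w s)%:E) - (a - b)%:E)%E.
  by congr (_ - _)%E; exact: (integralB_EFin measurableT IY IZ).
by rewrite -[X in (X - _ - _)%E](fineK fY) -[X in (_ - X - _)%E](fineK fZ) -/a -/b -!EFinB subrr.
Qed.

End Telescope.

(** The error splits as (E X - E X_L) plus the sum over l of m_l minus the sample mean of level l,
    with m_l = E X_l - E X_(l-1). [level_estimate] bounds each summand. The measure carries its
    sigma-finite structure, as the Tonelli arguments require. *)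
Lemma mlmc_sigma_finite
  (R : realType) (dO dS : measure_display)
  (Om : measurableType dO) (S : measurableType dS)
  (P : probability Om R) (mu : {sigma_finite_measure set S -> \bar R})
  (happrox : approx_by_averaging mu)
  (q p : R) (hq : 2 <= q) (hp1 : 1 <= p) (hpq : p <= q)
  (X : Om -> S -> R) (hX : LpS_rv P mu p X)
  (Xs : nat -> Om -> S -> R)
  (hX0 : Xs 0%N = (fun _ _ => 0))
  (hXs : forall l, (0 < l)%N -> in_LpLq P mu p q (Xs l))
  (cost : nat -> R)
  (alpha beta gamma Ca Cb Cg A : R)
  (ha : 0 < alpha) (hb : 0 < beta) (hg : 0 < gamma)
  (hCa : 0 < Ca) (hCb : 0 < Cb) (hCg : 0 < Cg) (hA : 1 < A)
  (N : nat -> nat) (c1 c2 : R) (hc1 : 0 < c1) (hc2 : 0 < c2)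
  (hN : forall l, (0 < l)%N -> c1 * A ^+ l <= (N l)%:R <= c2 * A ^+ l)
  (hbias : forall l, (0 < l)%N ->
     (normLpS mu p (fun s => (expect P X s - expect P (Xs l) s)%R)
        <= (Ca * (N l)%:R `^ (- alpha))%:E)%E)
  (hvar : forall l, (0 < l)%N ->
     (normLpLq P mu p q
        (fun w s => (Xs l w s - expect P (Xs l) s
                    - (Xs l.-1 w s - expect P (Xs l.-1) s))%R)
        <= (Cb * (N l)%:R `^ (- beta))%:E)%E)
  (hcost : forall l, (0 < l)%N -> cost l <= Cg * (N l)%:R `^ gamma)
  (xi : nat -> nat -> Om -> S -> R)
  (hxi : forall l, (0 < l)%N ->
     (forall j, LpS_rv P mu p (xi l j) /\
        same_law P mu (xi l j) (fun w s => Xs l w s - Xs l.-1 w s)) /\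
     indep_family P mu (xi l)) :
  exists K : R, 0 < K /\
  forall eps : R, 0 < eps -> eps <= 1 / 2 ->
  exists (L : nat) (M : nat -> nat),
    (0 < L)%N /\ (forall l, (0 < M l)%N) /\
    (normLqLp P mu q p
       (fun w s => (expect P X s -
          \sum_(1 <= l < L.+1) ((M l)%:R^-1 * \sum_(1 <= j < (M l).+1) xi l j w s))%R)
       < eps%:E)%E /\
    \sum_(1 <= l < L.+1) ((M l)%:R * cost l) <= K * mlmc_rate A alpha beta gamma eps.
Proof.
have p0 := lt_le_trans ltr01 hp1; have hq1 := le_trans hp1 hpq.
have q0 := lt_le_trans ltr01 hq1.
have A0 := lt_trans ltr01 hA.
have inX l : in_LpLq P mu p q (Xs l).
  by case: l => [|l]; [rewrite hX0; exact: in_LpLq_cst0|exact: hXs].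
pose C0 := moment_const P hq `^ q^-1.
have C00 : 0 < C0 by rewrite powR_gt0 // moment_const_gt0.
(* These constants replace N_l by A^l: the lower bound c1 serves the negative powers, c2 in [B3] the
   cost. *)
pose B1 := Ca * c1 `^ (- alpha); pose B2 := C0 * (Cb * c1 `^ (- beta)).
pose B3 := Cg * c2 `^ gamma.
have B10 : 0 < B1 by rewrite mulr_gt0 ?powR_gt0.
have B20 : 0 < B2 by apply: mulr_gt0 => //; rewrite mulr_gt0 ?powR_gt0.
have B30 : 0 < B3 by rewrite mulr_gt0 ?powR_gt0.
have Npos l : (0 < l)%N -> 0 < (N l)%:R :> R.
  by move=> /hN /andP[h _]; apply: lt_le_trans h; rewrite mulr_gt0// exprn_gt0.
have Nneg a l : 0 <= a -> (0 < l)%N ->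
    (N l)%:R `^ (- a) <= c1 `^ (- a) * A `^ (- a * l%:R).
  move=> a0 l0; have /andP[h _] := hN l l0.
  have -> : c1 `^ (- a) * A `^ (- a * l%:R) = (c1 * A ^+ l) `^ (- a).
    by rewrite powRM ?(ltW hc1) ?exprn_ge0 ?(ltW A0)// -powR_mulrn ?(ltW A0)// -powRrM mulrC (mulrC l%:R) mulrC.
  rewrite !powRN lef_pV2 ?posrE ?powR_gt0 ?Npos ?mulr_gt0 ?exprn_gt0//.
  by apply: ge0_ler_powR; rewrite ?nnegrE ?mulr_ge0 ?exprn_ge0 ?ler0n// ltW.
have Nup l : (0 < l)%N -> (N l)%:R `^ gamma <= c2 `^ gamma * A `^ (gamma * l%:R).
  move=> l0; have /andP[_ h] := hN l l0.
  have -> : c2 `^ gamma * A `^ (gamma * l%:R) = (c2 * A ^+ l) `^ gamma.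
    by rewrite powRM ?(ltW hc2) ?exprn_ge0 ?(ltW A0)// -powR_mulrn ?(ltW A0)// -powRrM (mulrC l%:R).
  by apply: ge0_ler_powR; rewrite ?nnegrE ?mulr_ge0 ?exprn_ge0 ?ler0n// ltW.
pose m l (s : S) := expect P (Xs l) s - expect P (Xs l.-1) s.
have mm l : measurable_fun setT (m l).
  by apply: measurable_funB; apply: measurable_expect; exact: (inX _).1.1.
pose dX l w s := Xs l w s - Xs l.-1 w s.
have dvar l : (0 < l)%N -> (normLpLq P mu p q (fun w s => dX l w s - m l s)%R <=
    (Cb * (N l)%:R `^ (- beta))%:E)%E.
  move=> l0; rewrite (_ : (fun w s => _) = (fun w s => Xs l w s - expect P (Xs l) s
                    - (Xs l.-1 w s - expect P (Xs l.-1) s))); first exact: hvar.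
  by apply/funext => w; apply/funext => s; rewrite /dX /m; ring.
(* Nothing is assumed about [xi 0], which does not enter the sum. *)
pose xi' l := if l is 0%N then (fun _ _ _ => 0) else xi l.
pose F (M : nat -> nat) l w s :=
  m l s - (M l)%:R^-1 * \sum_(1 <= j < (M l).+1) xi' l j w s.
have mF M l : measurable_fun setT (fun z : Om * S => F M l z.1 z.2).
  apply: measurable_funB; first exact: (measurableT_comp (mm l)).
  apply: measurable_funM => //; apply: measurable_sum => j.
  case: l => [|l] //=; exact: ((hxi l.+1 isT).1 j).1.1.
have level M l : (0 < l)%N -> (0 < M l)%N -> (normLqLp P mu q p (F M l) <=
    (B2 * (M l)%:R `^ (- 2^-1) * A `^ (- beta * l%:R))%:E)%E.
  move=> l0 Ml; have [hx iY] := hxi l l0.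
  have xiE : xi' l = xi l by case: l l0 {Ml hx iY}.
  have mean0 := mean_increment0 hp1 hq1 (inX l) (inX l.-1).
  have dXL : LpS_rv P mu p (dX l) by exact: LpS_rvB (inX l).1 (inX l.-1).1.
  have Dfin : (normLpLq P mu p q (fun w s => dX l w s - m l s)%R < +oo)%E.
    by apply: le_lt_trans (dvar l l0) _; rewrite ltry.
  have := level_estimate hq hp1 hpq happrox (mm l) dXL Dfin mean0
    (fun j => (hx j).1) (fun j => (hx j).2) iY Ml.
  rewrite /F xiE => /le_trans; apply.
  apply: (@le_trans _ _ ((C0 * (M l)%:R `^ (- 2^-1))%:E *
      (Cb * (c1 `^ (- beta) * A `^ (- beta * l%:R)))%:E)%E).
    apply: lee_wpmul2l; first by rewrite lee_fin mulr_ge0 ?powR_ge0.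
    apply: le_trans (dvar l l0) _; rewrite lee_fin; apply: ler_wpM2l; first exact: ltW.
    by apply: Nneg => //; exact: ltW.
  by rewrite -EFinM lee_fin /B2 le_eqVlt; apply/orP; left; apply/eqP; ring.
have [K [K0 HK]] := mlmc_complexity hA beta ha hg B10 B20.
exists (B3 * K); split; first exact: mulr_gt0.
move=> eps e0 e1; have [L [M [L0 [M0 [err cst]]]]] := HK eps e0 e1.
exists L, M; split => //; split => //; split; last first.
  rewrite -mulrA; apply: (@le_trans _ _ (B3 * \sum_(1 <= l < L.+1)
      (M l)%:R * A `^ (gamma * l%:R))); last by apply: ler_wpM2l => //; exact: ltW.
  rewrite big_distrr/=; apply: ler_sum_nat => l /andP[l0 _].
  rewrite mulrCA; apply: ler_wpM2l => //; apply: (le_trans (hcost l l0)).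
  by rewrite /B3 -mulrA; apply: ler_wpM2l; [exact: ltW|exact: Nup].
have -> : (fun w s => expect P X s -
    \sum_(1 <= l < L.+1) ((M l)%:R^-1 * \sum_(1 <= j < (M l).+1) xi l j w s)) =
  (fun w s => (expect P X s - expect P (Xs L) s) + \sum_(1 <= l < L.+1) F M l w s).
  apply/funext => w; apply/funext => s.
  have -> : \sum_(1 <= l < L.+1) F M l w s = \sum_(1 <= l < L.+1) m l s -
      \sum_(1 <= l < L.+1) ((M l)%:R^-1 * \sum_(1 <= j < (M l).+1) xi l j w s).
    by rewrite -sumrB; apply: eq_big_nat => -[|l].
  have -> : \sum_(1 <= l < L.+1) m l s = expect P (Xs L) s.
    elim: (L) => [|k IH]; first by rewrite big_geq// hX0 expect0.
    by rewrite big_nat_recr//= IH /m/= addrC subrK.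
  by ring.
have mB : measurable_fun setT (fun z : Om * S => expect P X z.2 - expect P (Xs L) z.2).
  apply: (measurableT_comp (_ : measurable_fun setT (fun s => expect P X s - expect P (Xs L) s))) => //.
  by apply: measurable_funB; apply: measurable_expect; [exact: hX.1|exact: (inX _).1.1].
have mS : measurable_fun setT (fun z : Om * S => \sum_(1 <= l < L.+1) F M l z.1 z.2).
  by apply: measurable_sum => l; exact: mF.
apply: le_lt_trans (normLqLp_triangle P mu hp1 hq1 mB mS) _.
apply: (@le_lt_trans _ _ ((B1 * A `^ (- alpha * L%:R))%:E +
   \sum_(1 <= l < L.+1) (B2 * (M l)%:R `^ (- 2^-1) * A `^ (- beta * l%:R))%:E)%E); last first.
  by rewrite sumEFin -EFinD lte_fin.
apply: leeD.
  rewrite normLqLp_cst//; apply: (le_trans (hbias L L0)); rewrite lee_fin /B1 -mulrA.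
  by apply: ler_wpM2l; [exact: ltW|apply: Nneg => //; exact: ltW].
apply: le_trans (normLqLp_sum_le _ _ _ hp1 hq1 (mF M)) _.
rewrite big_nat [leRHS]big_nat; apply: lee_sum => l /andP[l0 _].
exact: level.
Qed.

(** * From sigma-finiteness as a hypothesis to the bundled structure *)

Section SigmaFiniteStructure.
Context {R : realType} d (T : measurableType d).

(** An alias of mu that mentions the proof h, so that a canonical instance can be attached to it. *)
Definition with_sigma_finite (mu : {measure set T -> \bar R})
  (h : sigma_finite [set: T] mu) : set T -> \bar R := mu.

Section Instances.
Variables (mu : {measure set T -> \bar R}) (h : sigma_finite [set: T] mu).

HB.instance Definition _ := Measure.copy (with_sigma_finite h) mu.

HB.instance Definition _ :=
  Measure_isSigmaFinite.Build _ _ _ (with_sigma_finite h) h.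

End Instances.

(** The equality holds between bundled measures, which allows substitution for mu throughout the
    theorem. Once mu is destructed, both bundles are convertible. *)
Lemma sigma_finite_measure_of (mu : {measure set T -> \bar R}) :
  sigma_finite [set: T] mu ->
  exists mu' : {sigma_finite_measure set T -> \bar R},
    (mu' : {measure set T -> \bar R}) = mu.
Proof.
move=> h; exists (with_sigma_finite h).
by case: mu h => f [a b] h; exact: erefl.
Qed.

End SigmaFiniteStructure.

Unset Implicit Arguments. Set Strict Implicit. Set Printing Implicit Defensive.

Theorem mainTheorem14
  (R : realType) (dO dS : measure_display)
  (Om : measurableType dO) (S : measurableType dS)
  (P : probability Om R) (mu : {measure set S -> \bar R})
  (hsigma : sigma_finite [set: S] mu)
  (happrox : approx_by_averaging mu)
  (q p : R) (hq : 2 <= q) (hp1 : 1 <= p) (hpq : p <= q)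
  (X : Om -> S -> R) (hX : in_LqLp P mu 1 p X)
  (Xs : nat -> Om -> S -> R)
  (hX0 : Xs 0%N = (fun _ _ => 0))
  (hXs : forall l, (0 < l)%N -> in_LqLp P mu q p (Xs l) /\ in_LpLq P mu p q (Xs l))
  (cost : nat -> R) (hcost0 : forall l, (0 < l)%N -> 0 <= cost l)
  (alpha beta gamma Ca Cb Cg A : R)
  (ha : 0 < alpha) (hb : 0 < beta) (hg : 0 < gamma)
  (hCa : 0 < Ca) (hCb : 0 < Cb) (hCg : 0 < Cg) (hA : 1 < A)
  (N : nat -> nat)
  (hN : exists c1 c2 : R, 0 < c1 /\ 0 < c2 /\
          forall l, (0 < l)%N -> c1 * A ^+ l <= (N l)%:R <= c2 * A ^+ l)
  (hbias : forall l, (0 < l)%N ->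
     (normLpS mu p (fun s => (expect P X s - expect P (Xs l) s)%R)
        <= (Ca * (N l)%:R `^ (- alpha))%:E)%E)
  (hvar : forall l, (0 < l)%N ->
     (normLpLq P mu p q
        (fun w s => (Xs l w s - expect P (Xs l) s
                    - (Xs l.-1 w s - expect P (Xs l.-1) s))%R)
        <= (Cb * (N l)%:R `^ (- beta))%:E)%E)
  (hcost : forall l, (0 < l)%N -> cost l <= Cg * (N l)%:R `^ gamma)
  (xi : nat -> nat -> Om -> S -> R)
  (hxi : forall l, (0 < l)%N ->
     (forall j, LpS_rv P mu p (xi l j) /\
        same_law P mu (xi l j) (fun w s => Xs l w s - Xs l.-1 w s)) /\
     indep_family P mu (xi l)) :
  exists K : R, 0 < K /\
  forall eps : R, 0 < eps -> eps <= 1 / 2 ->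
  exists (L : nat) (M : nat -> nat),
    (0 < L)%N /\ (forall l, (0 < l <= L)%N -> (0 < M l)%N) /\
    (normLqLp P mu q p
       (fun w s => (expect P X s -
          \sum_(1 <= l < L.+1) ((M l)%:R^-1 * \sum_(1 <= j < (M l).+1) xi l j w s))%R)
       < eps%:E)%E /\
    \sum_(1 <= l < L.+1) ((M l)%:R * cost l) <= K * mlmc_rate A alpha beta gamma eps.
Proof.
have [mu' muE] := sigma_finite_measure_of hsigma.
subst mu.
have [c1 [c2 [c10 [c20 Nc]]]] := hN.
have [K [K0 H]] := @mlmc_sigma_finite _ _ _ _ _ P mu' happrox q p hq hp1 hpq
  X hX.1 Xs hX0 (fun l l0 => (hXs l l0).2) cost alpha beta gamma Ca Cb Cg A
  ha hb hg hCa hCb hCg hA N c1 c2 c10 c20 Nc hbias hvar hcost xi hxi.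
exists K; split => // eps e0 e1; have [L [M [L0 [M0 ?]]]] := H eps e0 e1.
by exists L, M.
Qed.
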